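(* There is an infinite antichain of equivalence relations on $\omega$ which are enumerable in indices and lie between $=^{ce}$ and $E_0^{ce}$: namely, there are equivalence relations $A_0,A_1,\ldots$ on $\omega$, each enumerable in indices, such that $=^{ce}\ \le_c A_n\le_c E_0^{ce}$ for all $n$, and $A_n\not\le_c A_m$ for all $n\neq m$.
   Context: $(W_e)_{e\in\omega}$ is a standard uniform enumeration of the c.e.\ subsets of $\omega$. $i=^{ce}j\iff W_i=W_j$; $i\,E_0^{ce}\,j\iff W_i\triangle W_j$ is finite. $E\le_c F$ means there is a computable $f$ with $x\,E\,y\iff f(x)\,F\,f(y)$. An equivalence relation $R$ on $\omega$ with $W_i=W_j\Rightarrow i\,R\,j$ (i.e., $R$ is of the form $i\,R\,j\iff W_i\,E\,W_j$ for an equivalence relation $E$ on $2^\omega$) is enumerable in indices if there is a computable $\alpha:\omega\times\omega\to\omega$ such that $i\,R\,j\iff(\exists n)(W_{\alpha(i,n)}=W_j)$. *)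

(* Defs.v *)
From Stdlib Require Import Arith List Relation_Definitions.
From Stdlib Require Cantor.

Declare Scope ce_scope.
Delimit Scope ce_scope with ce.
Open Scope ce_scope.

Definition cpair (x y : nat) : nat := Cantor.to_nat (x, y).
Arguments cpair : simpl never.
Notation "⟨ x , y ⟩" := (cpair x y) (at level 0, format "⟨ x ,  y ⟩") : ce_scope.

(* [phi e x y] reads: the [e]-th partial recursive function converges on [x]
   with value [y].  As in Kleene's indexing, the index itself carries the
   scheme: its first component selects one of constants, successor, the two
   projections, pairing, composition, primitive recursion, minimization, and
   its second component holds the parameters (a constant, or indices).  Every
   number is an index; one whose first component is greater than 7 denotes the
   nowhere defined function.  The clauses that match on [⟨a, b⟩] cover every
   argument, because the pairing is onto. *)
Inductive phi : nat -> nat -> nat -> Prop :=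
| phi_const k x : phi ⟨0, k⟩ x k
| phi_succ k x : phi ⟨1, k⟩ x (S x)
| phi_fst k a b : phi ⟨2, k⟩ ⟨a, b⟩ a
| phi_snd k a b : phi ⟨3, k⟩ ⟨a, b⟩ b
| phi_pair e f x y z :
    phi e x y -> phi f x z -> phi ⟨4, ⟨e, f⟩⟩ x ⟨y, z⟩
| phi_comp e f x y z :
    phi f x y -> phi e y z -> phi ⟨5, ⟨e, f⟩⟩ x z
| phi_rec_0 e f a y :
    phi e a y -> phi ⟨6, ⟨e, f⟩⟩ ⟨a, 0⟩ y
| phi_rec_S e f a n y z :
    phi ⟨6, ⟨e, f⟩⟩ ⟨a, n⟩ y -> phi f ⟨a, ⟨n, y⟩⟩ z ->
    phi ⟨6, ⟨e, f⟩⟩ ⟨a, S n⟩ z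
(* [g] records the nonzero values met before the first zero. *)
| phi_mu e a n (g : nat -> nat) :
    (forall m, m < n -> phi e ⟨a, m⟩ (S (g m))) ->
    phi e ⟨a, n⟩ 0 -> phi ⟨7, e⟩ a n.

Definition computable (f : nat -> nat) : Prop :=
  exists e, forall x, phi e x (f x).

Definition computable2 (f : nat -> nat -> nat) : Prop :=
  exists e, forall x y, phi e ⟨x, y⟩ (f x y).

Definition W (e : nat) : nat -> Prop := fun x => exists y, phi e x y.

Definition set_eq (A B : nat -> Prop) : Prop := forall x, A x <-> B x.

Definition symdiff (A B : nat -> Prop) : nat -> Prop :=
  fun x => (A x /\ ~ B x) \/ (B x /\ ~ A x).

Definition finite (A : nat -> Prop) : Prop :=
  exists l : list nat, forall x, A x -> In x l.

Definition eq_ce : relation nat := fun i j => set_eq (W i) (W j).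

Definition E0_ce : relation nat := fun i j => finite (symdiff (W i) (W j)).

Definition reducible (E F : relation nat) : Prop :=
  exists f : nat -> nat,
    computable f /\ forall x y, E x y <-> F (f x) (f y).

Definition enumerable_in_indices (R : relation nat) : Prop :=
  (forall i j, set_eq (W i) (W j) -> R i j) /\
  exists alpha : nat -> nat -> nat,
    computable2 alpha /\
    forall i j, R i j <-> exists n, set_eq (W (alpha i n)) (W j).

(* Main.v *)
(** Fix [N >= 3] and read a c.e. set [X] as follows: the elements below [N] are
    vertices of the cycle [C_N], and [X] is full if it contains everything from
    [N] on.  [cycle_rel N] identifies two sets when they contain the same
    vertices and, in addition, are equal if they contain no vertex, and are both
    full or both not full if the vertices form a single vertex or edge of [C_N].

    Sets without vertices give a copy of [=^ce].  Given a reduction from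
    [cycle_rel N] to [cycle_rel M], let [X] be the full set on a vertex or edge.
    Fullness is a properly Pi_2 event and its negation properly Sigma_2, so by
    the recursion theorem the image of [X] can lie neither in a class given by
    equality nor in a Sigma_2 class; it is again a full set on a vertex or edge.
    Another use of the recursion theorem shows that the induced map from vertices
    and edges of [C_N] to those of [C_M] is monotone, and it is injective.  Hence
    [C_N] is a subgraph of [C_M], which forces [N = M]. *)

Require Import Defs.
From Stdlib Require Import Relation_Definitions Arith Lia Bool List Classical.
From Stdlib Require Cantor.

(** * Projections of the pairing function *)

Definition cfst (p : nat) : nat := fst (Cantor.of_nat p).
Definition csnd (p : nat) : nat := snd (Cantor.of_nat p).

Lemma cfst_pair a b : cfst ⟨a, b⟩ = a.
Proof. unfold cfst, cpair. now rewrite Cantor.cancel_of_to. Qed.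

Lemma csnd_pair a b : csnd ⟨a, b⟩ = b.
Proof. unfold csnd, cpair. now rewrite Cantor.cancel_of_to. Qed.

Lemma cpair_eta p : ⟨cfst p, csnd p⟩ = p.
Proof.
  unfold cfst, csnd, cpair. rewrite <- surjective_pairing.
  apply Cantor.cancel_to_of.
Qed.

Lemma cpair_inj a b c d : ⟨a, b⟩ = ⟨c, d⟩ -> a = c /\ b = d.
Proof.
  intros H. split.
  - now rewrite <- (cfst_pair a b), H, cfst_pair.
  - now rewrite <- (csnd_pair a b), H, csnd_pair.
Qed.

Ltac csimp := repeat (rewrite cfst_pair || rewrite csnd_pair).
Ltac csimp_in H := repeat (rewrite cfst_pair in H || rewrite csnd_pair in H).

(** * Closure properties of computable functions *)

Lemma computable_ext f g :
  (forall p, f p = g p) -> computable f -> computable g.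
Proof. intros E [e He]. exists e. intros p. rewrite <- E. apply He. Qed.

Lemma computable_const k : computable (fun _ => k).
Proof. exists ⟨0, k⟩. intros x. apply phi_const. Qed.

Lemma computable_pair f g :
  computable f -> computable g -> computable (fun p => ⟨f p, g p⟩).
Proof.
  intros [e He] [d Hd]. exists ⟨4, ⟨e, d⟩⟩. intros x. now apply phi_pair.
Qed.

Lemma phi_cfst x : phi ⟨2, 0⟩ x (cfst x).
Proof. rewrite <- (cpair_eta x) at 1. apply phi_fst. Qed.

Lemma phi_csnd x : phi ⟨3, 0⟩ x (csnd x).
Proof. rewrite <- (cpair_eta x) at 1. apply phi_snd. Qed.

(** No clause of [phi] is the identity, so it is assembled by pairing the two projections. *)
Definition id_index : nat := ⟨4, ⟨⟨2, 0⟩, ⟨3, 0⟩⟩⟩.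

Lemma phi_id x : phi id_index x x.
Proof.
  rewrite <- (cpair_eta x) at 2.
  apply phi_pair; [apply phi_cfst | apply phi_csnd].
Qed.

Lemma computable_id : computable (fun p => p).
Proof. exists id_index. apply phi_id. Qed.

Lemma computable_comp h f :
  computable h -> computable f -> computable (fun p => h (f p)).
Proof.
  intros [e He] [d Hd]. exists ⟨5, ⟨e, d⟩⟩. intros x.
  eapply phi_comp; [apply Hd | apply He].
Qed.

Lemma computable_cfst f : computable f -> computable (fun p => cfst (f p)).
Proof. apply (computable_comp cfst). exists ⟨2, 0⟩. apply phi_cfst. Qed.

Lemma computable_csnd f : computable f -> computable (fun p => csnd (f p)).
Proof. apply (computable_comp csnd). exists ⟨3, 0⟩. apply phi_csnd. Qed.

Lemma computable_S f : computable f -> computable (fun p => S (f p)).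
Proof. apply (computable_comp S). exists ⟨1, 0⟩. apply phi_succ. Qed.

(** The primitive recursion clause carries one parameter [a]. Taking the whole input [p] as this
    parameter lets base, step and length all depend on [p]. *)
Lemma computable_rec (b n : nat -> nat) (h : nat -> nat -> nat -> nat) :
  computable b ->
  computable (fun q => h (cfst q) (cfst (csnd q)) (csnd (csnd q))) ->
  computable n ->
  computable (fun p => nat_rect (fun _ => nat) (b p) (h p) (n p)).
Proof.
  intros [e He] [d Hd] Hn.
  pose (r q := nat_rect (fun _ => nat) (b (cfst q)) (h (cfst q)) (csnd q)).
  assert (Hr : computable r).
  { exists ⟨6, ⟨e, d⟩⟩. intros q. rewrite <- (cpair_eta q) at 1. unfold r.
    induction (csnd q) as [|k IH]; simpl.
    - apply phi_rec_0, He.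
    - eapply phi_rec_S; [exact IH|].
      generalize (nat_rect (fun _ => nat) (b (cfst q)) (h (cfst q)) k).
      intros y. specialize (Hd ⟨cfst q, ⟨k, y⟩⟩).
      revert Hd. now csimp. }
  eapply computable_ext; [|apply (computable_comp r);
    [exact Hr | apply (computable_pair (fun p => p) n);
      [apply computable_id | exact Hn]]].
  intros p. unfold r. now csimp.
Qed.

Lemma computable_pred f : computable f -> computable (fun p => pred (f p)).
Proof.
  intros Hf.
  eapply computable_ext; [|apply (computable_rec (fun _ => 0) f (fun _ k _ => k));
    [apply computable_const | | exact Hf]].
  - intros p. simpl. now destruct (f p).
  - apply computable_cfst, computable_csnd, computable_id.
Qed.

Lemma computable_add f g :
  computable f -> computable g -> computable (fun p => f p + g p).
Proof.
  intros Hf Hg.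
  eapply computable_ext; [|apply (computable_rec f g (fun _ _ y => S y));
    [exact Hf | | exact Hg]].
  - intros p. simpl. induction (g p) as [|k IH]; simpl; lia.
  - apply computable_S, computable_csnd, computable_csnd, computable_id.
Qed.

Lemma computable_sub f g :
  computable f -> computable g -> computable (fun p => f p - g p).
Proof.
  intros Hf Hg.
  eapply computable_ext; [|apply (computable_rec f g (fun _ _ y => pred y));
    [exact Hf | | exact Hg]].
  - intros p. simpl. induction (g p) as [|k IH]; simpl; lia.
  - apply computable_pred, computable_csnd, computable_csnd, computable_id.
Qed.

(** * Decidable predicates, as computable 0-1 valued functions *)

Definition decidable (b : nat -> bool) : Prop :=
  computable (fun p => Nat.b2n (b p)).

Lemma decidable_ext b c : (forall p, b p = c p) -> decidable b -> decidable c.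
Proof. intros E. apply computable_ext. intros p. now rewrite E. Qed.

(** A recursion of length [Nat.b2n (b p)]: no step leaves [g p], a single step overwrites it by
    [f p]. *)
Lemma computable_if b f g :
  decidable b -> computable f -> computable g ->
  computable (fun p => if b p then f p else g p).
Proof.
  intros Hb Hf Hg.
  eapply computable_ext; [|apply (computable_rec g (fun p => Nat.b2n (b p))
    (fun p _ _ => f p)); [exact Hg | | exact Hb]].
  - intros p. simpl. now destruct (b p).
  - apply (computable_comp f); [exact Hf | apply computable_cfst, computable_id].
Qed.

Lemma decidable_const c : decidable (fun _ => c).
Proof. exact (computable_const (Nat.b2n c)). Qed.

Lemma decidable_if b c d :
  decidable b -> decidable c -> decidable d ->
  decidable (fun p => if b p then c p else d p).
Proof.
  intros Hb Hc Hd. eapply computable_ext; [|exact (computable_if _ _ _ Hb Hc Hd)].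
  intros p. simpl. now destruct (b p).
Qed.

Lemma decidable_and b c :
  decidable b -> decidable c -> decidable (fun p => b p && c p).
Proof.
  intros Hb Hc. apply (decidable_if b c (fun _ => false)); auto using decidable_const.
Qed.

Lemma decidable_or b c :
  decidable b -> decidable c -> decidable (fun p => b p || c p).
Proof.
  intros Hb Hc. apply (decidable_if b (fun _ => true) c); auto using decidable_const.
Qed.

Lemma decidable_neg b : decidable b -> decidable (fun p => negb (b p)).
Proof.
  intros Hb. apply (decidable_if b (fun _ => false) (fun _ => true));
    auto using decidable_const.
Qed.

Lemma decidable_leb f g :
  computable f -> computable g -> decidable (fun p => f p <=? g p).
Proof.
  (* With truncated subtraction, [1 - (f p - g p)] is 1 if [f p <= g p] and 0 otherwise. *)
  intros Hf Hg. eapply computable_ext; [|apply (computable_sub (fun _ => 1)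
    (fun p => f p - g p)); [apply computable_const | now apply computable_sub]].
  intros p. cbv beta. destruct (Nat.leb_spec (f p) (g p)); simpl Nat.b2n; lia.
Qed.

Lemma decidable_ltb f g :
  computable f -> computable g -> decidable (fun p => f p <? g p).
Proof. intros. now apply (decidable_leb (fun p => S (f p)) g); [apply computable_S|]. Qed.

Lemma decidable_eqb f g :
  computable f -> computable g -> decidable (fun p => f p =? g p).
Proof.
  intros Hf Hg.
  eapply decidable_ext; [|apply decidable_and; apply decidable_leb;
    [exact Hf | exact Hg | exact Hg | exact Hf]].
  intros p. cbv beta.
  destruct (Nat.leb_spec (f p) (g p)), (Nat.leb_spec (g p) (f p)),
    (Nat.eqb_spec (f p) (g p)); simpl; lia.
Qed.

Lemma decidable_eqb_bool b c :
  decidable b -> decidable c -> decidable (fun p => Bool.eqb (b p) (c p)).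
Proof.
  intros Hb Hc. eapply decidable_ext; [|exact (decidable_eqb _ _ Hb Hc)].
  intros p. simpl. now destruct (b p), (c p).
Qed.

(** * Bounded quantifiers *)

Fixpoint ball (n : nat) (P : nat -> bool) : bool :=
  match n with 0 => true | S k => ball k P && P k end.

Definition bex (n : nat) (P : nat -> bool) : bool := negb (ball n (fun k => negb (P k))).

Lemma ball_spec n P : ball n P = true <-> forall k, k < n -> P k = true.
Proof.
  induction n as [|n IH]; simpl.
  - split; [lia | reflexivity].
  - rewrite andb_true_iff, IH. split.
    + intros [H1 H2] k Hk. destruct (Nat.eq_dec k n) as [->|]; [exact H2|].
      apply H1. lia.
    + intros H. split; [intros k Hk|]; apply H; lia.
Qed.

Lemma ball_false n P : ball n P = false -> exists k, k < n /\ P k = false.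
Proof.
  induction n as [|n IH]; simpl; [discriminate|].
  rewrite andb_false_iff. intros [H|H].
  - destruct (IH H) as (k & Hk & E). exists k. split; [lia | exact E].
  - exists n. split; [lia | exact H].
Qed.

Lemma bex_spec n P : bex n P = true <-> exists k, k < n /\ P k = true.
Proof.
  unfold bex. rewrite negb_true_iff. split.
  - intros H. destruct (ball_false _ _ H) as (k & Hk & E).
    exists k. split; [exact Hk | now apply negb_false_iff].
  - intros (k & Hk & E). apply not_true_iff_false. rewrite ball_spec.
    intros H. specialize (H k Hk). rewrite E in H. discriminate.
Qed.

Lemma decidable_ball n (P : nat -> nat -> bool) :
  computable n -> decidable (fun q => P (cfst q) (csnd q)) ->
  decidable (fun p => ball (n p) (P p)).
Proof.
  intros Hn HP.
  eapply computable_ext; [|apply (computable_rec (fun _ => 1) n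
    (fun p k y => if (y =? 1) && P p k then 1 else 0));
    [apply computable_const | | exact Hn]].
  - intros p. cbv beta. induction (n p) as [|k IH]; [reflexivity|].
    cbn [nat_rect ball]. rewrite IH. now destruct (ball k (P p)), (P p k).
  - apply computable_if; [apply decidable_and | | ]; try apply computable_const.
    + apply decidable_eqb; [|apply computable_const].
      apply computable_csnd, computable_csnd, computable_id.
    + eapply decidable_ext; [|apply (computable_comp _
        (fun q => ⟨cfst q, cfst (csnd q)⟩) HP)].
      * intros p. cbv beta. now csimp.
      * apply computable_pair; [|apply computable_cfst];
          [apply computable_cfst | apply computable_csnd]; apply computable_id.
Qed.

Lemma decidable_bex n (P : nat -> nat -> bool) :
  computable n -> decidable (fun q => P (cfst q) (csnd q)) ->
  decidable (fun p => bex (n p) (P p)).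
Proof.
  intros Hn HP. apply decidable_neg.
  apply (decidable_ball n (fun p k => negb (P p k))); [exact Hn|].
  now apply (decidable_neg (fun q => P (cfst q) (csnd q))).
Qed.

Lemma decidable_existsb_eqb f l :
  computable f -> decidable (fun p => existsb (Nat.eqb (f p)) l).
Proof.
  intros Hf. induction l as [|a l IH]; simpl.
  - apply decidable_const.
  - apply decidable_or; [|exact IH].
    apply decidable_eqb; [exact Hf | apply computable_const].
Qed.

Ltac comp_step :=
  cbv beta;
  first
    [ assumption
    | simple apply computable_const
    | simple apply computable_id
    | simple apply computable_pair
    | simple apply computable_cfst
    | simple apply computable_csnd
    | simple apply computable_S
    | simple apply computable_pred
    | simple apply computable_add
    | simple apply computable_sub
    | simple apply computable_if
    | simple apply decidable_const
    | simple apply decidable_if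
    | simple apply decidable_and
    | simple apply decidable_or
    | simple apply decidable_neg
    | simple apply decidable_ltb
    | simple apply decidable_leb
    | simple apply decidable_eqb
    | simple apply decidable_eqb_bool
    | simple apply decidable_ball
    | simple apply decidable_bex
    | simple apply decidable_existsb_eqb ].

Ltac comp := repeat comp_step.

(** * An abstract machine for [phi] *)

(* Stacks are [0 = ⟨0, 0⟩] (empty) or [⟨tag, ⟨data, rest⟩⟩] with a nonzero tag. *)
Definition eval_conf (e x K : nat) : nat := ⟨0, ⟨⟨e, x⟩, K⟩⟩.
Definition ret_conf (y K : nat) : nat := ⟨1, ⟨y, K⟩⟩.
Definition push (tag data K : nat) : nat := ⟨tag, ⟨data, K⟩⟩.

(** Frames on the stack: tag 1 awaits the first component of a pair and stores index and input of
    the second; tag 2 stores the finished first component; tag 3 stores the outer function of a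
    composition; tags 4 and 5 store the state of a recursion step and of a search. An index of no
    scheme returns [c] itself, so the machine loops on it. *)
Definition eval_step (c e d x K : nat) : nat :=
  if cfst e =? 0 then ret_conf d K
  else if cfst e =? 1 then ret_conf (S x) K
  else if cfst e =? 2 then ret_conf (cfst x) K
  else if cfst e =? 3 then ret_conf (csnd x) K
  else if cfst e =? 4 then eval_conf (cfst d) x (push 1 ⟨csnd d, x⟩ K)
  else if cfst e =? 5 then eval_conf (csnd d) x (push 3 (cfst d) K)
  else if cfst e =? 6 then
    if csnd x =? 0 then eval_conf (cfst d) (cfst x) K
    else eval_conf e ⟨cfst x, pred (csnd x)⟩
           (push 4 ⟨csnd d, ⟨cfst x, pred (csnd x)⟩⟩ K)
  else if cfst e =? 7 then eval_conf d ⟨x, 0⟩ (push 5 ⟨d, ⟨x, 0⟩⟩ K)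
  else c.

Definition ret_step (c y tag d K : nat) : nat :=
  if tag =? 1 then eval_conf (cfst d) (csnd d) (push 2 y K)
  else if tag =? 2 then ret_conf ⟨d, y⟩ K
  else if tag =? 3 then eval_conf d y K
  else if tag =? 4 then
    eval_conf (cfst d) ⟨cfst (csnd d), ⟨csnd (csnd d), y⟩⟩ K
  else if tag =? 5 then
    if y =? 0 then ret_conf (csnd (csnd d)) K
    else eval_conf (cfst d) ⟨cfst (csnd d), S (csnd (csnd d))⟩
           (push 5 ⟨cfst d, ⟨cfst (csnd d), S (csnd (csnd d))⟩⟩ K)
  else c.

Definition step (c : nat) : nat :=
  if cfst c =? 0
  then eval_step c (cfst (cfst (csnd c))) (csnd (cfst (cfst (csnd c))))
         (csnd (cfst (csnd c))) (csnd (csnd c))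
  else ret_step c (cfst (csnd c)) (cfst (csnd (csnd c)))
         (cfst (csnd (csnd (csnd c)))) (csnd (csnd (csnd (csnd c)))).

Definition steps (s c : nat) : nat := nat_rect (fun _ => nat) c (fun _ => step) s.

Definition halted (c : nat) : bool := (cfst c =? 1) && (cfst (csnd (csnd c)) =? 0).

Lemma computable_step f : computable f -> computable (fun p => step (f p)).
Proof.
  apply (computable_comp step).
  unfold step, eval_step, ret_step, eval_conf, ret_conf, push. comp.
Qed.

Lemma computable_steps f g :
  computable f -> computable g -> computable (fun p => steps (f p) (g p)).
Proof.
  intros Hf Hg. apply (computable_rec g f (fun _ _ y => step y)); auto.
  apply computable_step. comp.
Qed.

Lemma steps_S s c : steps (S s) c = steps s (step c).
Proof. induction s as [|s IH]; [reflexivity|]. simpl in *. now rewrite IH. Qed.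

Lemma steps_add s t c : steps (s + t) c = steps t (steps s c).
Proof.
  revert c. induction s as [|s IH]; intros c; [reflexivity|].
  change (S s + t) with (S (s + t)). now rewrite !steps_S, IH.
Qed.

Lemma step_eval e x K :
  step (eval_conf e x K) = eval_step (eval_conf e x K) e (csnd e) x K.
Proof. unfold step, eval_conf. csimp. reflexivity. Qed.

Lemma step_ret y tag d K :
  step (ret_conf y (push tag d K)) = ret_step (ret_conf y (push tag d K)) y tag d K.
Proof. unfold step, ret_conf, push. csimp. reflexivity. Qed.

Lemma halted_step c : halted c = true -> step c = c.
Proof.
  unfold halted, step. rewrite andb_true_iff, !Nat.eqb_eq. intros [-> ->]. reflexivity.
Qed.

Lemma halted_steps s c : halted c = true -> steps s c = c.
Proof.
  intros H. induction s as [|s IH]; [reflexivity|]. rewrite steps_S.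
  now rewrite (halted_step c H).
Qed.

(** Induction on the derivation. The stack [K] stays arbitrary because the induction hypotheses are
    applied with a frame pushed on it. *)
Lemma steps_phi e x y :
  phi e x y -> forall K, exists s, steps s (eval_conf e x K) = ret_conf y K.
Proof.
  induction 1 as [k x|k x|k a b|k a b|e f x y z _ IHe _ IHf|e f x y z _ IHf _ IHe
    |e f a y _ IHe|e f a n y z _ IHr _ IHf|e a n g _ IHe _ IH0]; intros K.
  1-4: exists 1; rewrite steps_S, step_eval; unfold eval_step; csimp; reflexivity.
  - destruct (IHe (push 1 ⟨f, x⟩ K)) as [s1 H1].
    destruct (IHf (push 2 y K)) as [s2 H2].
    exists (S (s1 + S (s2 + 1))).
    rewrite steps_S, step_eval. unfold eval_step. csimp. simpl Nat.eqb. cbv iota.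
    rewrite steps_add, H1, steps_S, step_ret. unfold ret_step. csimp.
    simpl Nat.eqb. cbv iota. rewrite steps_add, H2, steps_S, step_ret. reflexivity.
  - destruct (IHf (push 3 e K)) as [s1 H1]. destruct (IHe K) as [s2 H2].
    exists (S (s1 + S s2)).
    rewrite steps_S, step_eval. unfold eval_step. csimp. simpl Nat.eqb. cbv iota.
    rewrite steps_add, H1, steps_S, step_ret. exact H2.
  - destruct (IHe K) as [s H]. exists (S s).
    rewrite steps_S, step_eval. unfold eval_step. csimp. exact H.
  - destruct (IHr (push 4 ⟨f, ⟨a, n⟩⟩ K)) as [s1 H1].
    destruct (IHf K) as [s2 H2].
    exists (S (s1 + S s2)).
    rewrite steps_S, step_eval. unfold eval_step. csimp. simpl Nat.eqb. cbv iota.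
    simpl pred. rewrite steps_add, H1, steps_S, step_ret. unfold ret_step. csimp.
    exact H2.
  (* The search arrives at each candidate [m <= n] with exactly one frame above [K]. *)
  - assert (Hloop : forall m, m <= n -> exists s,
      steps s (eval_conf ⟨7, e⟩ a K) = eval_conf e ⟨a, m⟩ (push 5 ⟨e, ⟨a, m⟩⟩ K)).
    { induction m as [|m IHm]; intros Hm.
      - exists 1. rewrite steps_S, step_eval. unfold eval_step. csimp. reflexivity.
      - destruct IHm as [s1 H1]; [lia|].
        destruct (IHe m Hm (push 5 ⟨e, ⟨a, m⟩⟩ K)) as [s2 H2].
        exists (s1 + (s2 + 1)).
        rewrite steps_add, H1, steps_add, H2, steps_S, step_ret.
        unfold ret_step. csimp. reflexivity. }
    destruct (Hloop n (le_n n)) as [s1 H1].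
    destruct (IH0 (push 5 ⟨e, ⟨a, n⟩⟩ K)) as [s2 H2].
    exists (s1 + (s2 + 1)).
    rewrite steps_add, H1, steps_add, H2, steps_S, step_ret.
    unfold ret_step. csimp. reflexivity.
Qed.

Lemma halted_eval e x K : halted (eval_conf e x K) = false.
Proof. unfold halted, eval_conf. csimp. reflexivity. Qed.

Lemma halted_ret y tag d K : halted (ret_conf y (push (S tag) d K)) = false.
Proof. unfold halted, ret_conf, push. csimp. reflexivity. Qed.

Lemma halted_ret_nil y : halted (ret_conf y 0) = true.
Proof. unfold halted, ret_conf. csimp. reflexivity. Qed.

(** Converse of [steps_phi]: a halting run must at some time return a value to the stack it started
    with. The strict bound [s' < s] allows the induction hypothesis to be applied again to the
    remaining run. *)
Lemma halting_run s : forall e x K,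
  halted (steps s (eval_conf e x K)) = true ->
  exists y s', s' < s /\ phi e x y /\ halted (steps s' (ret_conf y K)) = true.
Proof.
  induction s as [s IH] using lt_wf_ind. intros e x K Hs.
  destruct s as [|s]; [simpl in Hs; rewrite halted_eval in Hs; discriminate|].
  rewrite steps_S, step_eval in Hs. unfold eval_step in Hs.
  rewrite <- (cpair_eta e). set (d := csnd e) in *.
  destruct (Nat.eqb_spec (cfst e) 0) as [->|_].
  { exists d, s. split; [lia|]. split; [apply phi_const | exact Hs]. }
  destruct (Nat.eqb_spec (cfst e) 1) as [->|_].
  { exists (S x), s. split; [lia|]. split; [apply phi_succ | exact Hs]. }
  destruct (Nat.eqb_spec (cfst e) 2) as [->|_].
  { exists (cfst x), s. split; [lia|]. split; [|exact Hs].
    rewrite <- (cpair_eta x) at 1. apply phi_fst. }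
  destruct (Nat.eqb_spec (cfst e) 3) as [->|_].
  { exists (csnd x), s. split; [lia|]. split; [|exact Hs].
    rewrite <- (cpair_eta x) at 1. apply phi_snd. }
  destruct (Nat.eqb_spec (cfst e) 4) as [->|_].
  { apply IH in Hs as (y & s1 & L1 & P1 & Hs); [|lia].
    destruct s1 as [|s1]; [simpl in Hs; rewrite halted_ret in Hs; discriminate|].
    rewrite steps_S, step_ret in Hs. unfold ret_step in Hs. simpl in Hs.
    csimp_in Hs.
    apply IH in Hs as (z & s2 & L2 & P2 & Hs); [|lia].
    destruct s2 as [|s2]; [simpl in Hs; rewrite halted_ret in Hs; discriminate|].
    rewrite steps_S, step_ret in Hs. unfold ret_step in Hs. simpl in Hs.
    exists ⟨y, z⟩, s2. split; [lia|]. split; [|exact Hs].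
    rewrite <- (cpair_eta d). now apply phi_pair. }
  destruct (Nat.eqb_spec (cfst e) 5) as [->|_].
  { apply IH in Hs as (y & s1 & L1 & P1 & Hs); [|lia].
    destruct s1 as [|s1]; [simpl in Hs; rewrite halted_ret in Hs; discriminate|].
    rewrite steps_S, step_ret in Hs. unfold ret_step in Hs. simpl in Hs.
    apply IH in Hs as (z & s2 & L2 & P2 & Hs); [|lia].
    exists z, s2. split; [lia|]. split; [|exact Hs].
    rewrite <- (cpair_eta d). now apply phi_comp with y. }
  destruct (Nat.eqb_spec (cfst e) 6) as [E|_].
  { rewrite E. rewrite <- (cpair_eta x), <- (cpair_eta d).
    destruct (csnd x) as [|n] eqn:En; simpl in Hs.
    - apply IH in Hs as (y & s1 & L1 & P1 & Hs); [|lia].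
      exists y, s1. split; [lia|]. split; [|exact Hs]. now apply phi_rec_0.
    - apply IH in Hs as (y & s1 & L1 & P1 & Hs); [|lia].
      destruct s1 as [|s1]; [simpl in Hs; rewrite halted_ret in Hs; discriminate|].
      rewrite steps_S, step_ret in Hs. unfold ret_step in Hs. simpl in Hs.
      csimp_in Hs.
      apply IH in Hs as (z & s2 & L2 & P2 & Hs); [|lia].
      exists z, s2. split; [lia|]. split; [|exact Hs].
      apply phi_rec_S with y; [|exact P2].
      rewrite <- (cpair_eta e), E in P1. fold d in P1.
      now rewrite <- (cpair_eta d) in P1. }
  destruct (Nat.eqb_spec (cfst e) 7) as [->|_].
  (* Inner induction on the steps left; [g] accumulates the values met so far, in the form that
     [phi_mu] demands. *)
  { assert (Hloop : forall t m g, t <= s ->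
      (forall k, k < m -> phi d ⟨x, k⟩ (S (g k))) ->
      halted (steps t (eval_conf d ⟨x, m⟩ (push 5 ⟨d, ⟨x, m⟩⟩ K))) = true ->
      exists y s', s' < t /\ phi ⟨7, d⟩ x y /\ halted (steps s' (ret_conf y K)) = true).
    { induction t as [t IHt] using lt_wf_ind. intros m g Ht Hg H.
      apply IH in H as (y & s1 & L1 & P1 & H); [|lia].
      destruct s1 as [|s1]; [simpl in H; rewrite halted_ret in H; discriminate|].
      rewrite steps_S, step_ret in H. unfold ret_step in H. simpl in H.
      csimp_in H.
      destruct y as [|y]; simpl in H.
      - exists m, s1. split; [lia|]. split; [|exact H]. now apply phi_mu with g.
      - apply IHt with (g := fun k => if k =? m then y else g k) in H
          as (z & s2 & L2 & P2 & H); [| lia | lia | ].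
        + exists z, s2. split; [lia|]. now split.
        + intros k Hk. destruct (Nat.eqb_spec k m) as [->|]; [exact P1|].
          apply Hg. lia. }
    destruct (Hloop s 0 (fun k => k) (le_n s)) as (y & s1 & L1 & P1 & H);
      [lia | exact Hs |].
    exists y, s1. split; [lia|]. now split. }
  (* First component above 7: the configuration is its own successor, so the same configuration
     halts in fewer steps. *)
  apply IH in Hs as (y & s1 & L1 & P1 & Hs); [|lia].
  exists y, s1. split; [lia|]. split; [|exact Hs]. unfold d. now rewrite cpair_eta.
Qed.

(** The machine is deterministic and halted configurations are fixed, so both runs agree once each
    is prolonged to [s + t] steps. *)
Lemma phi_functional e x y z : phi e x y -> phi e x z -> y = z.
Proof.
  intros Hy Hz.
  destruct (steps_phi _ _ _ Hy 0) as [s Hs], (steps_phi _ _ _ Hz 0) as [t Ht].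
  assert (E : ret_conf y 0 = ret_conf z 0).
  { rewrite <- (halted_steps t (ret_conf y 0)), <- Hs, <- steps_add by apply halted_ret_nil.
    rewrite Nat.add_comm, steps_add, Ht. apply halted_steps, halted_ret_nil. }
  unfold ret_conf in E. apply cpair_inj in E as [_ E]. now apply cpair_inj in E as [E _].
Qed.

(** * Stage approximations, the parameter theorem and the recursion theorem *)

(** The bound [x <= t] makes each stage a finite set: a large element can only appear at a late
    stage. *)
Definition stage (e t x : nat) : bool := (x <=? t) && halted (steps t (eval_conf e x 0)).

Lemma stage_le e t x : stage e t x = true -> x <= t.
Proof. unfold stage. rewrite andb_true_iff, Nat.leb_le. tauto. Qed.

Lemma stage_mono e t u x : t <= u -> stage e t x = true -> stage e u x = true.
Proof.
  unfold stage. rewrite !andb_true_iff, !Nat.leb_le. intros L [Hx H].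
  split; [lia|]. replace u with (t + (u - t)) by lia.
  now rewrite steps_add, halted_steps.
Qed.

Lemma stage_W e t x : stage e t x = true -> W e x.
Proof.
  unfold stage. rewrite andb_true_iff. intros [_ H].
  destruct (halting_run _ _ _ _ H) as (y & _ & _ & P & _). now exists y.
Qed.

Lemma W_stage_from e x t0 : W e x -> exists t, t0 <= t /\ stage e t x = true.
Proof.
  intros [y P]. destruct (steps_phi _ _ _ P 0) as [s Hs].
  exists (s + (x + t0)). split; [lia|]. unfold stage.
  rewrite steps_add, Hs, halted_steps, halted_ret_nil, andb_true_r by apply halted_ret_nil.
  apply Nat.leb_le. lia.
Qed.

Lemma W_stage e x : W e x -> exists t, stage e t x = true.
Proof. intros H. destruct (W_stage_from e x 0 H) as (t & _ & E). now exists t. Qed.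

Lemma decidable_stage f g h :
  computable f -> computable g -> computable h ->
  decidable (fun p => stage (f p) (g p) (h p)).
Proof.
  intros Hf Hg Hh. unfold stage, halted, eval_conf. comp; apply computable_steps; comp.
Qed.

Lemma phi_mu_inv e a n : phi ⟨7, e⟩ a n -> phi e ⟨a, n⟩ 0.
Proof.
  intros H. remember ⟨7, e⟩ as d eqn:E.
  destruct H; apply cpair_inj in E as [E1 E2]; try discriminate. now subst.
Qed.

Lemma phi_comp_inv e f x z :
  phi ⟨5, ⟨e, f⟩⟩ x z -> exists y, phi f x y /\ phi e y z.
Proof.
  intros H. remember ⟨5, ⟨e, f⟩⟩ as d eqn:E.
  destruct H; apply cpair_inj in E as [E1 E2]; try discriminate.
  apply cpair_inj in E2 as [-> ->]. eauto.
Qed.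

(** Index of the composition of [h] with the map sending [x] to [⟨p, x⟩]. *)
Definition smn (h p : nat) : nat := ⟨5, ⟨h, ⟨4, ⟨⟨0, p⟩, id_index⟩⟩⟩⟩.

Lemma W_smn h p x : W (smn h p) x <-> W h ⟨p, x⟩.
Proof.
  assert (P : phi ⟨4, ⟨⟨0, p⟩, id_index⟩⟩ x ⟨p, x⟩).
  { apply phi_pair; [apply phi_const | apply phi_id]. }
  split; intros [z H].
  - apply phi_comp_inv in H as (y & Hy & Hz). exists z.
    now rewrite (phi_functional _ _ _ _ P Hy).
  - exists z. now apply phi_comp with ⟨p, x⟩.
Qed.

Definition uncurry3 (b : nat -> nat -> nat -> bool) (q : nat) : bool :=
  b (cfst (cfst q)) (csnd (cfst q)) (csnd q).

(** Minimization looks for a zero, so it is applied to the negation of [b]; it converges exactly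
    when a witness [s] exists. *)
Lemma projection_index b :
  decidable (uncurry3 b) ->
  exists h, forall p x, W (smn h p) x <-> exists s, b p x s = true.
Proof.
  intros Hb.
  destruct (decidable_neg _ Hb) as [e He]. exists ⟨7, e⟩. intros p x.
  assert (He' : forall s, phi e ⟨⟨p, x⟩, s⟩ (Nat.b2n (negb (b p x s)))).
  { intros s. specialize (He ⟨⟨p, x⟩, s⟩). unfold uncurry3 in He.
    revert He. csimp. tauto. }
  rewrite W_smn. split.
  - intros [s H]. exists s. apply phi_mu_inv in H.
    pose proof (phi_functional _ _ _ _ H (He' s)) as E.
    now destruct (b p x s).
  - intros [s H].
    (* Descent to the least witness, below which all values are nonzero. *)
    induction s as [s IH] using lt_wf_ind.
    destruct (ball s (fun k => negb (b p x k))) eqn:Hk.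
    + exists s. apply phi_mu with (g := fun _ => 0).
      * intros m Hm. specialize (He' m). rewrite ball_spec in Hk.
        now rewrite Hk in He'.
      * specialize (He' s). now rewrite H in He'.
    + destruct (ball_false _ _ Hk) as (k & Lk & E).
      apply (IH k Lk). now apply negb_false_iff.
Qed.

Theorem parameter_theorem b :
  decidable (uncurry3 b) ->
  exists d, computable d /\ forall p x, W (d p) x <-> exists s, b p x s = true.
Proof.
  intros Hb. destruct (projection_index b Hb) as [h Hh].
  exists (smn h). split; [unfold smn; comp | exact Hh].
Qed.

(** Kleene's diagonal: with [h] an index for [b] at the self-application [smn p p], the fixed point
    is [smn h h]. *)
Theorem recursion_theorem b :
  decidable (uncurry3 b) ->
  exists e, forall x, W e x <-> exists s, b e x s = true.
Proof.
  intros Hb.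
  destruct (projection_index (fun p => b (smn p p))) as [h Hh].
  - eapply decidable_ext; [|apply (computable_comp _
      (fun q => ⟨⟨smn (cfst (cfst q)) (cfst (cfst q)), csnd (cfst q)⟩, csnd q⟩) Hb)].
    + intros q. unfold uncurry3. now csimp.
    + unfold smn. comp.
  - exists (smn h h). exact (Hh h).
Qed.

Ltac comp ::= repeat (first [comp_step | simple apply decidable_stage]).

(** Each of the finitely many [v < N] changes its status at most once. The bound [t0] is obtained
    classically and not computed from [e]. *)
Lemma stages_settle N e :
  exists t0, forall t v, t0 <= t -> v < N -> (stage e t v = true <-> W e v).
Proof.
  induction N as [|N [t0 IH]]; [exists 0; lia|].
  destruct (classic (W e N)) as [H|H].
  - destruct (W_stage_from e N t0 H) as (t1 & L & E). exists t1.
    intros t v Ht Hv. destruct (Nat.eq_dec v N) as [->|].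
    + split; [tauto|]. intros _. now apply stage_mono with t1.
    + apply IH; lia.
  - exists t0. intros t v Ht Hv. destruct (Nat.eq_dec v N) as [->|].
    + split; [apply stage_W | tauto].
    + apply IH; lia.
Qed.

Lemma stage_interval N e n t0 :
  (forall y, N <= y < n -> W e y) ->
  exists t, t0 <= t /\ forall y, N <= y < n -> stage e t y = true.
Proof.
  induction n as [|n IH]; intros H.
  - exists t0. split; [lia|]. intros y Hy. lia.
  - destruct IH as (t & Lt & Ht); [intros y Hy; apply H; lia|].
    destruct (le_lt_dec N n) as [L|L].
    + destruct (W_stage_from e n t) as (u & Lu & Hu); [apply H; lia|].
      exists u. split; [lia|]. intros y Hy.
      destruct (Nat.eq_dec y n) as [->|]; [exact Hu|].
      apply stage_mono with t; [exact Lu|]. apply Ht. lia.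
    + exists t. split; [exact Lt|]. intros y Hy. lia.
Qed.

(** * The relation attached to a cycle *)

Definition cyc_succ (N a : nat) : nat := if S a =? N then 0 else S a.

Definition edge (N a b : nat) : bool := (b =? a) || (b =? cyc_succ N a).

Definition same_tokens (N : nat) (X Y : nat -> Prop) : Prop :=
  forall v, v < N -> (X v <-> Y v).

Definition tokens_are (N a b : nat) (X : nat -> Prop) : Prop :=
  same_tokens N X (fun v => v = a \/ v = b).

(* [edge N a a] holds, so this covers single vertices as well as edges. *)
Definition valid (N : nat) (X : nat -> Prop) : Prop :=
  exists a b, a < N /\ b < N /\ edge N a b = true /\ tokens_are N a b X.

Definition no_token (N : nat) (X : nat -> Prop) : Prop := forall v, v < N -> ~ X v.

Definition full (N : nat) (X : nat -> Prop) : Prop := forall x, N <= x -> X x.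

(** Testing only [W i] in the last two clauses suffices, since the first clause transfers [valid]
    and [no_token] to [W j]. Sets with one and the same nonempty vertex set that is neither a vertex
    nor an edge form a single class. *)
Definition cycle_rel (N : nat) : relation nat := fun i j =>
  same_tokens N (W i) (W j) /\
  (valid N (W i) -> (full N (W i) <-> full N (W j))) /\
  (no_token N (W i) -> set_eq (W i) (W j)).

Lemma same_tokens_sym N X Y : same_tokens N X Y -> same_tokens N Y X.
Proof. intros H v Hv. symmetry. now apply H. Qed.

Lemma same_tokens_trans N X Y Z :
  same_tokens N X Y -> same_tokens N Y Z -> same_tokens N X Z.
Proof. intros H K v Hv. rewrite (H v Hv). now apply K. Qed.

Lemma valid_same N X Y : same_tokens N X Y -> valid N X -> valid N Y.
Proof.
  intros H (a & b & Ha & Hb & E & T). exists a, b. repeat (split; [assumption|]).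
  eapply same_tokens_trans; [apply same_tokens_sym; exact H | exact T].
Qed.

Lemma no_token_same N X Y : same_tokens N X Y -> no_token N X -> no_token N Y.
Proof. intros H T v Hv HY. apply (T v Hv). now apply (H v). Qed.

Lemma cycle_rel_equivalence N : equivalence nat (cycle_rel N).
Proof.
  split.
  - intros i. split; [intros v _; tauto|]. split; [tauto | intros _ x; tauto].
  - intros i j k (T1 & F1 & E1) (T2 & F2 & E2). split; [|split].
    + eapply same_tokens_trans; eauto.
    + intros V. rewrite (F1 V). apply F2. eapply valid_same; eauto.
    + intros V x. rewrite (E1 V x). apply E2. eapply no_token_same; eauto.
  - intros i j (T & F & E). split; [|split].
    + now apply same_tokens_sym.
    + intros V. symmetry. apply F. eapply valid_same; [|exact V].
      now apply same_tokens_sym.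
    + intros V x. symmetry. apply E. eapply no_token_same; [|exact V].
      now apply same_tokens_sym.
Qed.

Lemma cycle_rel_set_eq N i j : set_eq (W i) (W j) -> cycle_rel N i j.
Proof.
  intros H. split; [intros v _; apply H|]. split; [|now intros _].
  intros _. split; intros F x Hx; apply H, F, Hx.
Qed.

(** * Boolean versions of the tests, to be applied to stages *)

Definition tokens_eqb (N : nat) (X Y : nat -> bool) : bool :=
  ball N (fun v => Bool.eqb (X v) (Y v)).

Definition validb (N : nat) (X : nat -> bool) : bool :=
  bex N (fun a => bex N (fun b => edge N a b &&
    ball N (fun v => Bool.eqb (X v) ((v =? a) || (v =? b))))).

Definition no_tokenb (N : nat) (X : nat -> bool) : bool :=
  ball N (fun v => negb (X v)).

Definition fullb_upto (N : nat) (X : nat -> bool) (x : nat) : bool :=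
  ball (S x) (fun y => (y <? N) || X y).

Lemma tokens_eqb_spec N X Y :
  tokens_eqb N X Y = true <-> forall v, v < N -> X v = Y v.
Proof.
  unfold tokens_eqb. rewrite ball_spec.
  split; intros H v Hv; apply eqb_true_iff; now apply H.
Qed.

Lemma validb_spec N X : validb N X = true <-> valid N (fun v => X v = true).
Proof.
  unfold validb, valid, tokens_are, same_tokens. rewrite bex_spec. split.
  - intros (a & Ha & H). apply bex_spec in H as (b & Hb & H).
    apply andb_true_iff in H as [E H]. rewrite ball_spec in H.
    exists a, b. repeat split; auto; specialize (H v ltac:(assumption));
      apply eqb_prop in H; rewrite H, orb_true_iff, !Nat.eqb_eq; tauto.
  - intros (a & b & Ha & Hb & E & H). exists a. split; [exact Ha|].
    apply bex_spec. exists b. split; [exact Hb|].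
    rewrite E. apply ball_spec. intros v Hv. apply eqb_true_iff. apply eq_iff_eq_true.
    rewrite (H v Hv), orb_true_iff, !Nat.eqb_eq. tauto.
Qed.

Lemma no_tokenb_spec N X : no_tokenb N X = true <-> no_token N (fun v => X v = true).
Proof.
  unfold no_tokenb, no_token. rewrite ball_spec.
  split; intros H v Hv; specialize (H v Hv); now destruct (X v).
Qed.

Lemma fullb_upto_spec N X x :
  fullb_upto N X x = true <-> forall y, N <= y < S x -> X y = true.
Proof.
  unfold fullb_upto. rewrite ball_spec. split; intros H y Hy.
  - destruct (proj1 (orb_true_iff _ _) (H y (proj2 Hy))) as [L|L]; [|exact L].
    apply Nat.ltb_lt in L. lia.
  - apply orb_true_iff. destruct (Nat.ltb_spec y N); [now left|right].
    apply H. lia.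
Qed.

(** Shifting a set up by [N] removes all vertices, and on sets without vertices [cycle_rel N] is
    equality. *)
Lemma eq_ce_le_cycle_rel N : reducible eq_ce (cycle_rel N).
Proof.
  destruct (parameter_theorem (fun p x s => (N <=? x) && stage p s (x - N)))
    as (d & Hd & HW); [unfold uncurry3; comp|].
  assert (HW' : forall p x, W (d p) x <-> N <= x /\ W p (x - N)).
  { intros p x. rewrite HW. split.
    - intros [s H]. apply andb_true_iff in H as [L H]. apply Nat.leb_le in L.
      split; [exact L | eapply stage_W; eauto].
    - intros [L H]. apply W_stage in H as [s H]. exists s.
      apply Nat.leb_le in L. now rewrite L. }
  exists d. split; [exact Hd|]. intros i j. split.
  - intros E. apply cycle_rel_set_eq. intros x. rewrite !HW'. now rewrite (E (x - N)).
  - intros (_ & _ & E) x.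
    assert (Hn : no_token N (W (d i))).
    { intros v Hv H. apply HW' in H. lia. }
    specialize (E Hn (N + x)). rewrite !HW' in E.
    replace (N + x - N) with x in E by lia.
    split; intros H; apply E; split; auto; lia.
Qed.

(** * Reduction to [E0_ce] *)

Lemma finite_incl (A B : nat -> Prop) :
  (forall x, A x -> B x) -> finite B -> finite A.
Proof. intros H [l Hl]. exists l. auto. Qed.

Lemma finite_union (A B : nat -> Prop) :
  finite A -> finite B -> finite (fun x => A x \/ B x).
Proof.
  intros [l Hl] [k Hk]. exists (l ++ k). intros x [H|H]; apply in_or_app; auto.
Qed.

Lemma finite_symdiff_sym A B : finite (symdiff A B) -> finite (symdiff B A).
Proof. apply finite_incl. unfold symdiff. tauto. Qed.

Lemma finite_symdiff_trans A B C :
  finite (symdiff A B) -> finite (symdiff B C) -> finite (symdiff A C).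
Proof.
  intros H K. eapply finite_incl; [|exact (finite_union _ _ H K)].
  intros x. unfold symdiff. destruct (classic (B x)); tauto.
Qed.

Lemma finite_no_injection (A : nat -> Prop) (g : nat -> nat) :
  finite A -> (forall m n, g m = g n -> m = n) -> ~ (forall n, A (g n)).
Proof.
  intros [l Hl] Hg HA.
  assert (L : length (map g (seq 0 (S (length l)))) <= length l).
  { apply NoDup_incl_length.
    - apply NoDup_map_NoDup_ForallPairs; [|apply seq_NoDup].
      intros m n _ _. apply Hg.
    - intros x Hx. apply in_map_iff in Hx as (n & <- & _). auto. }
  rewrite length_map, length_seq in L. lia.
Qed.

(** This box will contain every element on which [E0_code] and [E0_limit] disagree. *)
Lemma finite_box (B : nat) :
  finite (fun y => cfst y < 3 /\
    (csnd y < B \/ (cfst (csnd y) < B /\ csnd (csnd y) < B))).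
Proof.
  set (l := seq 0 B ++ map (fun q => ⟨fst q, snd q⟩) (list_prod (seq 0 B) (seq 0 B))).
  exists (map (fun q => ⟨fst q, snd q⟩) (list_prod (seq 0 3) l)).
  intros y [H1 H2]. apply in_map_iff. exists (cfst y, csnd y).
  split; [apply cpair_eta|]. apply in_prod; [apply in_seq; lia|].
  apply in_or_app. destruct H2 as [H2|[H2 H3]].
  - left. apply in_seq. lia.
  - right. apply in_map_iff. exists (cfst (csnd y), csnd (csnd y)).
    split; [apply cpair_eta|]. apply in_prod; apply in_seq; lia.
Qed.

(** Column 0 holds infinitely many copies of each element while no vertex is seen, column 1
    infinitely many copies of each vertex, and column 2 grows along the initial segment filled from
    [N] on while the vertices are valid. The guards against [s] leave only finitely many errors from
    stages at which the vertices are still wrong. *)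
Definition E0_code (N i y s : nat) : bool :=
  if cfst y =? 0 then
    stage i s (cfst (csnd y)) && (csnd (csnd y) <=? s) && no_tokenb N (stage i s)
  else if cfst y =? 1 then (cfst (csnd y) <? N) && stage i s (cfst (csnd y))
  else if cfst y =? 2 then
    (csnd y <=? s) && validb N (stage i s) && fullb_upto N (stage i s) (N + csnd y)
  else false.

(* What the set enumerated by [E0_code N i] is, up to finitely many elements. *)
Definition E0_limit (N i y : nat) : Prop :=
  (cfst y = 0 /\ no_token N (W i) /\ W i (cfst (csnd y))) \/
  (cfst y = 1 /\ cfst (csnd y) < N /\ W i (cfst (csnd y))) \/
  (cfst y = 2 /\ valid N (W i) /\ full N (W i)).

(** Errors come from stages before [t0], when the vertices have not settled, or in column 2 from
    segments ending before the gap [k]. *)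
Lemma E0_code_limit N i :
  finite (symdiff (fun y => exists s, E0_code N i y s = true) (E0_limit N i)).
Proof.
  destruct (stages_settle N i) as [t0 Ht0].
  (* A gap in [W i] if there is one; otherwise [k] is the default 0. *)
  assert (Hk : exists k, full N (W i) \/ (N <= k /\ ~ W i k)).
  { destruct (classic (exists k, N <= k /\ ~ W i k)) as [[k Hk]|Hk].
    - now exists k; right.
    - exists 0. left. intros x Hx. apply NNPP. intros Hn. apply Hk. now exists x. }
  destruct Hk as [k Hk].
  assert (Hsame : forall s, t0 <= s -> same_tokens N (fun v => stage i s v = true) (W i)).
  { intros s Hs v Hv. now apply Ht0. }
  eapply finite_incl; [|exact (finite_box (t0 + k))].
  intros y [[[s Hs] Hn]|[Hy Hn]]; unfold E0_limit, E0_code in *.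
  - destruct (Nat.eqb_spec (cfst y) 0) as [E|].
    { rewrite E. split; [lia|]. right.
      apply andb_true_iff in Hs as [Hs Hv]. apply andb_true_iff in Hs as [Hx Hu].
      apply Nat.leb_le in Hu. rewrite no_tokenb_spec in Hv.
      pose proof (stage_le _ _ _ Hx). pose proof (stage_W _ _ _ Hx).
      destruct (le_lt_dec t0 s) as [L|L]; [|lia].
      exfalso. apply Hn. left. repeat split; auto.
      eapply no_token_same; eauto. }
    destruct (Nat.eqb_spec (cfst y) 1) as [E|].
    { apply andb_true_iff in Hs as [Hv Hx]. apply Nat.ltb_lt in Hv.
      exfalso. apply Hn. right; left. repeat split; auto. eapply stage_W; eauto. }
    destruct (Nat.eqb_spec (cfst y) 2) as [E|]; [|discriminate].
    rewrite E. split; [lia|]. left.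
    apply andb_true_iff in Hs as [Hs Hf]. apply andb_true_iff in Hs as [Hu Hv].
    apply Nat.leb_le in Hu. rewrite validb_spec in Hv. rewrite fullb_upto_spec in Hf.
    destruct (le_lt_dec t0 s) as [L|L]; [|lia].
    destruct Hk as [Hk|[Lk Hk]].
    + exfalso. apply Hn. right; right. repeat split; auto.
      eapply valid_same; eauto.
    + destruct (le_lt_dec k (N + csnd y)) as [L'|L']; [|lia].
      exfalso. apply Hk. eapply stage_W. apply Hf. lia.
  - exfalso. apply Hn. destruct Hy as [(E & HT & HX)|[(E & L & HX)|(E & HV & HF)]];
      rewrite E; simpl Nat.eqb; cbv iota.
    + destruct (W_stage_from _ _ (csnd (csnd y)) HX) as (s & L & Hs).
      exists s. rewrite Hs. apply Nat.leb_le in L. rewrite L. simpl.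
      apply no_tokenb_spec. intros v Hv H. apply (HT v Hv). eapply stage_W; eauto.
    + apply W_stage in HX as [s Hs]. exists s. rewrite Hs.
      apply Nat.ltb_lt in L. now rewrite L.
    (* A stage beyond [t0] sees the right vertices, and one beyond [csnd y] passes the guard. *)
    + destruct (stage_interval N i (S (N + csnd y)) (t0 + csnd y)) as (s & Ls & Hs).
      { intros x Hx. apply HF. lia. }
      exists s. apply andb_true_iff. split; [apply andb_true_iff; split|].
      * apply Nat.leb_le. lia.
      * apply validb_spec. eapply valid_same; [|exact HV].
        apply same_tokens_sym, Hsame. lia.
      * now apply fullb_upto_spec.
Qed.

(** Every fact that determines the class is coded by infinitely many elements, so a finite
    difference cannot hide it. *)
Lemma E0_limit_cycle_rel N i j :
  finite (symdiff (E0_limit N i) (E0_limit N j)) -> cycle_rel N i j.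
Proof.
  intros Hfin.
  assert (Hone : forall i j, finite (symdiff (E0_limit N i) (E0_limit N j)) ->
    (forall v, v < N -> W i v -> W j v) /\
    (no_token N (W i) -> forall x, W i x -> W j x) /\
    (valid N (W i) -> full N (W i) -> full N (W j))).
  { clear i j Hfin. intros i j Hfin.
    (* If [E0_limit N i] contains the range of an injection, then [E0_limit N j] meets that
       range. *)
    assert (H0 : forall g : nat -> nat, (forall m n, g m = g n -> m = n) ->
      (forall u, E0_limit N i (g u)) -> exists u, E0_limit N j (g u)).
    { intros g Hg Hi. apply NNPP. intros Hn.
      apply (finite_no_injection _ g Hfin Hg). intros u. left.
      split; [apply Hi|]. intros H. apply Hn. now exists u. }
    unfold E0_limit in H0. split; [|split].
    - intros v Hv HX. destruct (H0 (fun u => ⟨1, ⟨v, u⟩⟩)) as [u H].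
      + intros m n E. now apply cpair_inj in E as [_ E]; apply cpair_inj in E as [_ E].
      + intros u. csimp. tauto.
      + csimp_in H. destruct H as [H|[H|H]]; [lia | tauto | lia].
    - intros HT x HX. destruct (H0 (fun u => ⟨0, ⟨x, u⟩⟩)) as [u H].
      + intros m n E. now apply cpair_inj in E as [_ E]; apply cpair_inj in E as [_ E].
      + intros u. csimp. tauto.
      + csimp_in H. destruct H as [H|[H|H]]; [tauto | lia | lia].
    - intros HV HF. destruct (H0 (fun u => ⟨2, u⟩)) as [u H].
      + intros m n E. now apply cpair_inj in E as [_ E].
      + intros u. csimp. tauto.
      + csimp_in H. destruct H as [H|[H|H]]; [lia | lia | tauto]. }
  destruct (Hone i j Hfin) as (A1 & A2 & A3).
  destruct (Hone j i (finite_symdiff_sym _ _ Hfin)) as (B1 & B2 & B3).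
  assert (T : same_tokens N (W i) (W j)) by (intros v Hv; split; auto).
  split; [exact T|]. split.
  - intros V. split; [auto|]. apply B3. eapply valid_same; eauto.
  - intros V x. split; [auto|]. apply B2. eapply no_token_same; eauto.
Qed.

Lemma cycle_rel_le_E0 N : reducible (cycle_rel N) E0_ce.
Proof.
  destruct (parameter_theorem (E0_code N)) as (d & Hd & HW).
  { unfold uncurry3, E0_code, no_tokenb, validb, fullb_upto, edge, cyc_succ. comp. }
  assert (Hlim : forall i, finite (symdiff (W (d i)) (E0_limit N i))).
  { intros i. eapply finite_incl; [|exact (E0_code_limit N i)].
    intros y. unfold symdiff. rewrite (HW i y). tauto. }
  exists d. split; [exact Hd|]. intros i j. unfold E0_ce. split.
  - intros (T & F & E).
    eapply finite_symdiff_trans; [apply Hlim|].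
    apply finite_symdiff_sym. eapply finite_symdiff_trans; [apply Hlim|].
    exists nil. intros y H. exfalso.
    assert (HE : E0_limit N i y <-> E0_limit N j y).
    { assert (V : valid N (W i) <-> valid N (W j))
        by (split; apply valid_same; auto using same_tokens_sym).
      assert (Z : no_token N (W i) <-> no_token N (W j))
        by (split; apply no_token_same; auto using same_tokens_sym).
      unfold E0_limit. rewrite <- V, <- Z.
      specialize (T (cfst (csnd y))). unfold set_eq in E.
      split; (intros [(H1 & H2 & H3)|[(H1 & H2 & H3)|(H1 & H2 & H3)]];
        [left | right; left | right; right]); repeat split; auto.
      all: try (now apply T); try (now apply F); now apply E. }
    unfold symdiff in H. tauto.
  - intros H. apply E0_limit_cycle_rel.
    eapply finite_symdiff_trans; [apply finite_symdiff_sym, Hlim|].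
    eapply finite_symdiff_trans; [exact H | apply Hlim].
Qed.

(** * Enumerability in indices *)

(* As long as [follows] holds, the finite evidence is consistent with
   [cycle_rel N i j], where the classes of [i] and [j] are not full as witnessed
   by [N + k'] and [N + k] if they are valid. *)
Definition follows (N i s0 j k k' s : nat) : bool :=
  tokens_eqb N (stage j s0) (stage i s0) &&
  tokens_eqb N (stage i s) (stage i s0) &&
  tokens_eqb N (stage j s) (stage j s0) &&
  (negb (validb N (stage i s0)) ||
   (negb (stage j s (N + k)) && negb (stage i s (N + k')))).

(** The data [s0], [j], [k], [k'] guess a set related to [W i]. While the guess survives, [W j] is
    copied. After a refutation the set takes the vertices of [W i], and a larger [x] only when
    everything from [N] to [x] is in [W i]; it is then full iff [W i] is, whatever finite part was
    copied before. *)
Definition relative_code (N i s0 j k k' x s : nat) : bool :=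
  if no_tokenb N (stage i s0) then stage i s x
  else (s0 <=? s) &&
    (if follows N i s0 j k k' s then stage j s x
     else stage i s x && fullb_upto N (stage i s) x).

(** Stages only grow, so agreement with stage [s0] and absence of the two witnesses pass down to
    earlier stages: a refuted guess stays refuted. *)
Lemma follows_antitone N i s0 j k k' s s' :
  s0 <= s -> s <= s' -> follows N i s0 j k k' s' = true -> follows N i s0 j k k' s = true.
Proof.
  intros L L'. unfold follows.
  rewrite !andb_true_iff, !orb_true_iff, !andb_true_iff, !negb_true_iff, !tokens_eqb_spec.
  assert (Hsq : forall e v, stage e s' v = stage e s0 v -> stage e s v = stage e s0 v).
  { intros e v E. destruct (stage e s v) eqn:Es.
    - now rewrite <- E, (stage_mono e s s' v L' Es).
    - destruct (stage e s0 v) eqn:E0; [|reflexivity].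
      now rewrite (stage_mono e s0 s v L E0) in Es. }
  assert (Hf : forall e x, stage e s' x = false -> stage e s x = false).
  { intros e x E. destruct (stage e s x) eqn:Es; [|reflexivity].
    now rewrite (stage_mono e s s' x L' Es) in E. }
  intros [[[H1 H2] H3] H4]. repeat split; auto.
  destruct H4 as [H4|[H4 H5]]; auto.
Qed.

Lemma relative_code_sound N i s0 j k k' e :
  (forall x, W e x <-> exists s, relative_code N i s0 j k k' x s = true) ->
  cycle_rel N i e.
Proof.
  intros HW. unfold relative_code in HW.
  destruct (no_tokenb N (stage i s0)) eqn:H0.
  { apply cycle_rel_set_eq. intros x. rewrite HW. split; [apply W_stage|].
    intros [s H]. eapply stage_W; eauto. }
  assert (Hne : ~ no_token N (W i)).
  { intros H. apply not_true_iff_false in H0. apply H0, no_tokenb_spec.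
    intros v Hv E. apply (H v Hv). eapply stage_W; eauto. }
  destruct (classic (exists s, s0 <= s /\ follows N i s0 j k k' s = false))
    as [(s1 & L1 & F1)|Hf].
  - assert (Hafter : forall s, s1 <= s -> follows N i s0 j k k' s = false).
    { intros s L. destruct (follows N i s0 j k k' s) eqn:F; [|reflexivity].
      now rewrite (follows_antitone _ _ _ _ _ _ s1 s L1 L F) in F1. }
    split; [|split; [|tauto]].
    + intros v Hv. rewrite HW. split.
      * intros H. destruct (W_stage_from _ _ s1 H) as (s & L & Hs). exists s.
        rewrite (Hafter s L), Hs. apply andb_true_iff. split; [apply Nat.leb_le; lia|].
        apply fullb_upto_spec. intros y Hy. lia.
      * intros [s Hs]. apply andb_true_iff in Hs as [L Hs].
        destruct (follows N i s0 j k k' s) eqn:F.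
        -- unfold follows in F.
           rewrite !andb_true_iff, !tokens_eqb_spec in F. destruct F as [[[F2 F3] F4] _].
           apply stage_W with s0. rewrite <- F2, <- F4; auto.
        -- apply andb_true_iff in Hs as [Hs _]. eapply stage_W; eauto.
    + intros _. split.
      * intros H x Hx. apply HW.
        destruct (stage_interval N i (S x) s1) as (s & L & Hs); [intros; apply H; lia|].
        exists s. rewrite (Hafter s L), Hs by lia.
        apply andb_true_iff. split; [apply Nat.leb_le; lia|].
        now apply fullb_upto_spec.
      (* The element [x + s1] is too large to have been copied from [W j] before stage [s1], so it
         was enumerated after the refutation, together with evidence for all of [N] to [x + s1]. *)
      * intros H x Hx. specialize (H (x + s1) ltac:(lia)). apply HW in H as [s Hs].
        apply andb_true_iff in Hs as [_ Hs].
        destruct (follows N i s0 j k k' s) eqn:F.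
        -- apply stage_le in Hs. rewrite Hafter in F by lia. discriminate.
        -- apply andb_true_iff in Hs as [_ Hs]. rewrite fullb_upto_spec in Hs.
           apply stage_W with s. apply Hs. lia.
  - assert (F : forall s, s0 <= s -> follows N i s0 j k k' s = true).
    { intros s L. destruct (follows N i s0 j k k' s) eqn:F; [reflexivity|].
      exfalso. apply Hf. now exists s. }
    assert (HWj : forall x, W e x <-> W j x).
    { intros x. rewrite HW. split.
      - intros [s Hs]. apply andb_true_iff in Hs as [L Hs]. apply Nat.leb_le in L.
        rewrite (F s L) in Hs. eapply stage_W; eauto.
      - intros H. destruct (W_stage_from _ _ s0 H) as (s & L & Hs). exists s.
        rewrite (F s L), Hs, andb_true_r. now apply Nat.leb_le. }
    unfold follows in F.
    assert (Ti : forall v, v < N -> (W i v <-> stage i s0 v = true)).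
    { intros v Hv. split; [|apply stage_W]. intros H.
      destruct (W_stage_from _ _ s0 H) as (s & L & Hs). specialize (F s L).
      rewrite !andb_true_iff, !tokens_eqb_spec in F. destruct F as [[[_ F] _] _].
      now rewrite <- F. }
    split; [|split; [|tauto]].
    + intros v Hv. rewrite HWj, (Ti v Hv). pose proof (F s0 (le_n _)) as F0.
      rewrite !andb_true_iff, !tokens_eqb_spec in F0. destruct F0 as [[[F0 _] _] _].
      split.
      * intros H. apply stage_W with s0. now rewrite F0.
      * intros H. destruct (W_stage_from _ _ s0 H) as (s & L & Hs). specialize (F s L).
        rewrite !andb_true_iff, !tokens_eqb_spec in F. destruct F as [[[_ _] F] _].
        now rewrite <- F0, <- F.
    + intros V.
      assert (Vb : validb N (stage i s0) = true).
      { apply validb_spec. eapply valid_same; [|exact V]. intros v Hv. now apply Ti. }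
      assert (F' : forall s, s0 <= s ->
        stage j s (N + k) = false /\ stage i s (N + k') = false).
      { intros s L. specialize (F s L). rewrite Vb, !andb_true_iff in F.
        destruct F as [_ F]. simpl in F.
        now rewrite andb_true_iff, !negb_true_iff in F. }
      split; intros H; exfalso.
      * destruct (W_stage_from i (N + k') s0) as (s & L & Hs); [apply H; lia|].
        destruct (F' s L) as [_ E]. congruence.
      * destruct (W_stage_from j (N + k) s0) as (s & L & Hs); [apply HWj, H; lia|].
        destruct (F' s L) as [E _]. congruence.
Qed.

Lemma not_full_witness N X : ~ full N X -> exists k, ~ X (N + k).
Proof.
  intros H. apply NNPP. intros Hn. apply H. intros x Hx. apply NNPP. intros Hx'.
  apply Hn. exists (x - N). now replace (N + (x - N)) with x by lia.
Qed.

Lemma relative_code_complete N i j :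
  cycle_rel N i j ->
  exists s0 k k', forall x,
    W j x <-> exists s, relative_code N i s0 j k k' x s = true.
Proof.
  intros (T & F & E). unfold relative_code.
  destruct (classic (no_token N (W i))) as [HT|HT].
  { exists 0, 0, 0. intros x. rewrite <- (E HT x).
    replace (no_tokenb N (stage i 0)) with true.
    - split; [apply W_stage|]. intros [s H]. eapply stage_W; eauto.
    - symmetry. apply no_tokenb_spec. intros v Hv H. apply (HT v Hv).
      eapply stage_W; eauto. }
  destruct (stages_settle N i) as [ti Hi], (stages_settle N j) as [tj Hj].
  set (s0 := ti + tj).
  assert (Hsi : forall s v, s0 <= s -> v < N -> (stage i s v = true <-> W i v))
    by (intros; apply Hi; lia).
  assert (Hsj : forall s v, s0 <= s -> v < N -> (stage j s v = true <-> W i v))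
    by (intros; rewrite (T v) by assumption; apply Hj; lia).
  assert (H0 : no_tokenb N (stage i s0) = false).
  { apply not_true_iff_false. rewrite no_tokenb_spec. intros H. apply HT.
    intros v Hv HX. apply (H v Hv). now apply Hsi. }
  assert (HV : validb N (stage i s0) = true <-> valid N (W i)).
  { rewrite validb_spec. split; apply valid_same; intros v Hv.
    - now apply Hsi.
    - symmetry. now apply Hsi. }
  assert (Htok : forall s, s0 <= s ->
    tokens_eqb N (stage j s0) (stage i s0) && tokens_eqb N (stage i s) (stage i s0) &&
    tokens_eqb N (stage j s) (stage j s0) = true).
  { intros s L. rewrite !andb_true_iff, !tokens_eqb_spec.
    repeat split; intros v Hv; apply eq_iff_eq_true;
      repeat (rewrite Hsi by (auto; lia)); repeat (rewrite Hsj by (auto; lia)); tauto. }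
  assert (Halways : forall k k',
    (forall s, s0 <= s -> follows N i s0 j k k' s = true) ->
    exists s0 k k', forall x, W j x <-> exists s,
      (if no_tokenb N (stage i s0) then stage i s x
       else (s0 <=? s) && (if follows N i s0 j k k' s then stage j s x
         else stage i s x && fullb_upto N (stage i s) x)) = true).
  { intros k k' Hf. exists s0, k, k'. intros x. rewrite H0. split.
    - intros H. destruct (W_stage_from _ _ s0 H) as (s & L & Hs). exists s.
      rewrite (Hf s L), Hs, andb_true_r. now apply Nat.leb_le.
    - intros [s Hs]. apply andb_true_iff in Hs as [L Hs]. apply Nat.leb_le in L.
      rewrite (Hf s L) in Hs. eapply stage_W; eauto. }
  destruct (classic (valid N (W i))) as [V|V].
  (* Fullness is compared only on valid vertex sets, so the gap witnesses are dummies here. *)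
  2:{ apply (Halways 0 0). intros s L. unfold follows. rewrite (Htok s L). simpl.
      apply orb_true_iff. left. apply negb_true_iff, not_true_iff_false.
      now rewrite HV. }
  destruct (classic (full N (W i))) as [Hfull|Hfull].
  - assert (Hfull' : full N (W j)) by now apply F.
    (* Both sets are full, so the gap [N + 0] claimed for [W i] is wrong and the guess is refuted.
       What remains is the vertices of [W i] and everything from [N] on, which is [W j]. *)
    exists s0, 0, 0. intros x. rewrite H0.
    destruct (W_stage_from i (N + 0) s0) as (s1 & L1 & Hs1); [apply Hfull; lia|].
    assert (Hafter : forall s, s1 <= s -> follows N i s0 j 0 0 s = false).
    { intros s L. unfold follows. rewrite (stage_mono _ _ _ _ L Hs1).
      rewrite (proj2 HV V). simpl. now rewrite !andb_false_r. }
    split.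
    + intros H.
      assert (Hx : W i x).
      { destruct (le_lt_dec N x) as [L|L]; [now apply Hfull | now apply T]. }
      destruct (W_stage_from i x s1 Hx) as (s & L & Hs).
      destruct (stage_interval N i (S x) s) as (u & Lu & Hu); [intros; apply Hfull; lia|].
      exists u. rewrite Hafter by lia. rewrite (stage_mono i s u x Lu Hs).
      apply andb_true_iff. split; [apply Nat.leb_le; lia|]. now apply fullb_upto_spec.
    + intros [s Hs]. apply andb_true_iff in Hs as [_ Hs].
      destruct (follows N i s0 j 0 0 s); [eapply stage_W; eauto|].
      apply andb_true_iff in Hs as [Hs _]. apply stage_W in Hs.
      destruct (le_lt_dec N x) as [L|L]; [now apply Hfull' | now apply T].
  - assert (Hfull' : ~ full N (W j)) by now rewrite <- (F V).
    destruct (not_full_witness _ _ Hfull) as [k' Hk'].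
    destruct (not_full_witness _ _ Hfull') as [k Hk].
    apply (Halways k k'). intros s L. unfold follows. rewrite (Htok s L). simpl.
    apply orb_true_iff. right. rewrite andb_true_iff, !negb_true_iff.
    split; apply not_true_iff_false; intros H; apply stage_W in H; auto.
Qed.

(** The number [n] runs through all guesses [⟨s0, ⟨j, ⟨k, k'⟩⟩⟩]: wrong ones still stay in the
    class, and some guess yields [W j] exactly. *)
Lemma cycle_rel_enumerable N : enumerable_in_indices (cycle_rel N).
Proof.
  split; [apply cycle_rel_set_eq|].
  destruct (parameter_theorem (fun p => relative_code N (cfst p) (cfst (csnd p))
    (cfst (csnd (csnd p))) (cfst (csnd (csnd (csnd p)))) (csnd (csnd (csnd (csnd p))))))
    as (d & [e He] & HW).
  { unfold uncurry3, relative_code, follows, tokens_eqb, no_tokenb, validb,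
      fullb_upto, edge, cyc_succ. comp. }
  exists (fun i n => d ⟨i, n⟩). split; [now exists e|].
  intros i j. split.
  - intros H. destruct (relative_code_complete _ _ _ H) as (s0 & k & k' & Hx).
    exists ⟨s0, ⟨j, ⟨k, k'⟩⟩⟩. intros x. rewrite HW, Hx. csimp. reflexivity.
  - intros [n H]. destruct (cycle_rel_equivalence N) as [_ Htrans _].
    apply Htrans with (d ⟨i, n⟩); [|now apply cycle_rel_set_eq].
    eapply relative_code_sound. intros x. rewrite HW. rewrite cfst_pair. reflexivity.
Qed.

(** * Reductions induce embeddings of cycles *)

(** The vertices are prescribed, while the part from [N] on may react to the image [f e] of the very
    set under construction. *)
Lemma recursion_with_tokens N a b f (g : nat -> nat -> nat -> bool) :
  computable f -> decidable (uncurry3 g) ->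
  exists e, tokens_are N a b (W e) /\
    forall c, W e (N + c) <-> exists s, g (f e) c s = true.
Proof.
  intros Hf Hg.
  destruct (recursion_theorem (fun e x s =>
    if x <? N then (x =? a) || (x =? b) else g (f e) (x - N) s)) as [e He].
  - unfold uncurry3. apply decidable_if; [comp | comp |].
    eapply decidable_ext; [|apply (computable_comp _
      (fun q => ⟨⟨f (cfst (cfst q)), csnd (cfst q) - N⟩, csnd q⟩) Hg)].
    + intros q. unfold uncurry3. now csimp.
    + comp. apply (computable_comp f); comp.
  - exists e. split.
    + intros v Hv. rewrite He. apply Nat.ltb_lt in Hv. rewrite Hv.
      rewrite <- (Nat.eqb_eq v a), <- (Nat.eqb_eq v b), <- orb_true_iff.
      split; [now intros [_ H] | now exists 0].
    + intros c. rewrite He. replace (N + c <? N) with false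
        by (symmetry; apply Nat.ltb_ge; lia).
      now replace (N + c - N) with c by lia.
Qed.

Lemma full_shift N X : full N X <-> forall c, X (N + c).
Proof.
  split; intros H.
  - intros c. apply H. lia.
  - intros x Hx. replace x with (N + (x - N)) by lia. apply H.
Qed.

Lemma tokens_are_same N a b X Y :
  tokens_are N a b X -> tokens_are N a b Y -> same_tokens N X Y.
Proof.
  intros HX HY. eapply same_tokens_trans; [exact HX | now apply same_tokens_sym].
Qed.

Lemma valid_not_no_token N X : valid N X -> ~ no_token N X.
Proof.
  intros (a & b & Ha & _ & _ & T) H. apply (H a Ha), (T a Ha). now left.
Qed.

Lemma cycle_rel_valid N i j :
  valid N (W i) -> same_tokens N (W i) (W j) -> (full N (W i) <-> full N (W j)) ->
  cycle_rel N i j.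
Proof.
  intros V T F. split; [exact T|]. split; [tauto|].
  intros H. exfalso. exact (valid_not_no_token _ _ V H).
Qed.

(** Lets the vertices of a fixed image enter a decidable condition as a constant list. *)
Lemma bounded_part_list M (X : nat -> Prop) :
  exists l, forall v, existsb (Nat.eqb v) l = true <-> v < M /\ X v.
Proof.
  induction M as [|M [l IH]].
  - exists nil. intros v. simpl. split; [discriminate | lia].
  - destruct (classic (X M)) as [H|H]; [exists (M :: l) | exists l]; intros v; simpl.
    + rewrite orb_true_iff, IH, Nat.eqb_eq. split.
      * intros [->|[L HX]]; split; auto; lia.
      * intros [L HX]. destruct (Nat.eq_dec v M); [now left | right; split; [lia | auto]].
    + rewrite IH. split; intros [L HX]; (split; [|exact HX]); [lia|].
      destruct (Nat.eq_dec v M) as [->|]; [contradiction | lia].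
Qed.

Lemma cyc_succ_lt K a : a < K -> cyc_succ K a < K.
Proof. unfold cyc_succ. destruct (Nat.eqb_spec (S a) K); lia. Qed.

Lemma cyc_succ_neq K a : 2 <= K -> cyc_succ K a <> a.
Proof. unfold cyc_succ. destruct (Nat.eqb_spec (S a) K); lia. Qed.

Section Reduction.

Variables (N M : nat) (f : nat -> nat).
Hypothesis Hf : computable f.
Hypothesis Hred : forall x y, cycle_rel N x y <-> cycle_rel M (f x) (f y).

(** * The image of a full set on a vertex or edge *)

Section Image.

Variables a b e1 : nat.
Hypotheses (Ha : a < N) (Hb : b < N) (Hab : edge N a b = true).
Hypotheses (T1 : tokens_are N a b (W e1)) (F1 : full N (W e1)).

Let tokens_valid e : tokens_are N a b (W e) -> valid N (W e).
Proof. intros T. exists a, b. auto. Qed.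

Lemma image_of_full e :
  tokens_are N a b (W e) -> full N (W e) -> cycle_rel M (f e) (f e1).
Proof.
  intros T F. apply Hred. apply cycle_rel_valid; [auto | | tauto].
  eapply tokens_are_same; eauto.
Qed.

Lemma image_of_not_full e :
  tokens_are N a b (W e) -> ~ full N (W e) -> ~ cycle_rel M (f e) (f e1).
Proof.
  intros T F H. apply Hred in H as (_ & H & _). apply F, H; auto.
Qed.

Lemma image_of_not_full2 e e' :
  tokens_are N a b (W e) -> tokens_are N a b (W e') ->
  ~ full N (W e) -> ~ full N (W e') -> cycle_rel M (f e) (f e').
Proof.
  intros T T' F F'. apply Hred. apply cycle_rel_valid; [auto | | tauto].
  eapply tokens_are_same; eauto.
Qed.

(** Otherwise an [e0] that fills up once [f e0] shows a vertex cannot be full, so its image has no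
    vertex either. Full and non-full sets on these vertices then go to two fixed distinct sets, and
    a point [x] separating them lets some [e] be full exactly when [f e] says it is not. *)
Lemma image_has_token : ~ no_token M (W (f e1)).
Proof.
  intros H1.
  destruct (recursion_with_tokens N a b f (fun j c s => negb (no_tokenb M (stage j s))))
    as (e0 & T0 & W0); [exact Hf | unfold uncurry3, no_tokenb; comp |].
  assert (F0 : ~ full N (W e0)).
  { intros F. pose proof (F (N + 0) ltac:(lia)) as H. apply W0 in H as [s Hs].
    destruct (image_of_full e0 T0 F) as (T & _ & _).
    apply negb_true_iff in Hs. apply not_true_iff_false in Hs. apply Hs.
    apply no_tokenb_spec. intros v Hv Hx. apply stage_W in Hx.
    apply (H1 v Hv). now apply (T v Hv). }
  assert (H0 : no_token M (W (f e0))).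
  { intros v Hv Hx. apply W_stage in Hx as [s Hs]. apply F0, full_shift.
    intros c. apply W0. exists s. apply negb_true_iff, not_true_iff_false.
    rewrite no_tokenb_spec. intros H. exact (H v Hv Hs). }
  assert (Hdiff : exists x, symdiff (W (f e0)) (W (f e1)) x).
  { apply NNPP. intros Hn. apply (image_of_not_full e0 T0 F0), cycle_rel_set_eq.
    intros x. apply NNPP. intros Hx. apply Hn. exists x. unfold symdiff. tauto. }
  assert (Efull : forall e, tokens_are N a b (W e) -> full N (W e) ->
    set_eq (W (f e)) (W (f e1))).
  { intros e T F. destruct (image_of_full e T F) as (S1 & _ & E). apply E.
    eapply no_token_same; [apply same_tokens_sym; exact S1 | exact H1]. }
  assert (Enot : forall e, tokens_are N a b (W e) -> ~ full N (W e) ->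
    set_eq (W (f e)) (W (f e0))).
  { intros e T F. destruct (image_of_not_full2 e e0 T T0 F F0) as (S1 & _ & E). apply E.
    eapply no_token_same; [apply same_tokens_sym; exact S1 | exact H0]. }
  destruct Hdiff as [x [[X0 X1]|[X1 X0]]].
  (* Here [x] marks non-full sets, so [e] fills up when [x] enters [f e]. In the other case [x]
     marks full sets, and [e] keeps growing only while [x] is absent. *)
  - destruct (recursion_with_tokens N a b f (fun j c s => stage j s x))
      as (e & T & HW); [exact Hf | unfold uncurry3; comp |].
    destruct (classic (full N (W e))) as [F|F].
    + pose proof (F (N + 0) ltac:(lia)) as H. apply HW in H as [s Hs].
      apply X1, (Efull e T F). eapply stage_W; eauto.
    + apply F, full_shift. intros c. apply HW. apply W_stage. now apply (Enot e T F).
  - destruct (recursion_with_tokens N a b f (fun j c s => (c <=? s) && negb (stage j s x)))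
      as (e & T & HW); [exact Hf | unfold uncurry3; comp |].
    destruct (classic (full N (W e))) as [F|F].
    + apply (Efull e T F) in X1. apply W_stage in X1 as [s Hs].
      rewrite full_shift in F. pose proof (F s) as H. apply HW in H as [u Hu].
      apply andb_true_iff in Hu as [L Hu]. apply Nat.leb_le in L.
      now rewrite (stage_mono _ _ _ _ L Hs) in Hu.
    + apply F, full_shift. intros c. apply HW. exists c. rewrite Nat.leb_refl.
      apply negb_true_iff, not_true_iff_false. intros Hs. apply stage_W in Hs.
      apply X0. now apply (Enot e T F).
Qed.

(* Otherwise the class of [f e1] would be Sigma_2, while being full is not:
   the recursion theorem yields an [e] that is full iff [f e] is outside that class. *)
Lemma image_valid_full : valid M (W (f e1)) /\ full M (W (f e1)).
Proof.
  apply NNPP. intros Hn. pose proof image_has_token as H1.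
  destruct (bounded_part_list M (W (f e1))) as [l Hl].
  (* Validity of the one set [W (f e1)] is a fixed truth value and is built into the program. *)
  assert (Hvb : exists vb : bool, vb = true <-> valid M (W (f e1))).
  { destruct (classic (valid M (W (f e1)))); [exists true | exists false];
      intuition discriminate. }
  destruct Hvb as [vb Hvb].
  destruct (recursion_with_tokens N a b f (fun j c s =>
    ((c <=? s) && negb (tokens_eqb M (stage j s) (fun v => existsb (Nat.eqb v) l))) ||
    (vb && fullb_upto M (stage j s) (M + c))))
    as (e & T & HW); [exact Hf | unfold uncurry3, tokens_eqb, fullb_upto; comp |].
  destruct (classic (full N (W e))) as [F|F].
  - destruct (image_of_full e T F) as (S1 & S2 & _).
    destruct (stages_settle M (f e)) as [t0 Ht0].
    assert (Hk : exists k, valid M (W (f e1)) -> ~ W (f e) (M + k)).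
    { destruct (classic (valid M (W (f e1)))) as [V|V]; [|exists 0; tauto].
      destruct (not_full_witness M (W (f e))) as [k Hk]; [|now exists k].
      intros HF. apply Hn. split; [exact V|]. apply S2; [|exact HF].
      eapply valid_same; [apply same_tokens_sym; exact S1 | exact V]. }
    destruct Hk as [k Hk]. rewrite full_shift in F.
    (* At [t0 + k] neither disjunct can fire: the stage is too late for wrong vertices, and the
       segment runs past the gap [M + k]. *)
    pose proof (F (t0 + k)) as H. apply HW in H as [s Hs].
    apply orb_true_iff in Hs as [Hs|Hs]; apply andb_true_iff in Hs as [L Hs].
    + apply Nat.leb_le in L. apply negb_true_iff, not_true_iff_false in Hs.
      apply Hs, tokens_eqb_spec. intros v Hv. apply eq_iff_eq_true.
      rewrite Ht0 by (auto; lia). rewrite (Hl v), (S1 v Hv). tauto.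
    + apply Hk; [now apply Hvb|]. rewrite fullb_upto_spec in Hs.
      apply stage_W with s. apply Hs. lia.
  - pose proof (image_of_not_full e T F) as HE. apply HE.
    destruct (not_full_witness _ _ F) as [c Hc]. rewrite HW in Hc.
    assert (S1 : same_tokens M (W (f e)) (W (f e1))).
    { destruct (stages_settle M (f e)) as [t0 Ht0].
      intros v Hv. rewrite <- (Ht0 (t0 + c) v) by (auto; lia).
      destruct (tokens_eqb M (stage (f e) (t0 + c)) (fun v => existsb (Nat.eqb v) l)) eqn:E.
      - rewrite tokens_eqb_spec in E. rewrite (E v Hv), (Hl v). tauto.
      - exfalso. apply Hc. exists (t0 + c). rewrite E. simpl.
        apply orb_true_iff. left. rewrite andb_true_r. apply Nat.leb_le. lia. }
    split; [exact S1|]. split.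
    + intros V. assert (V1 : valid M (W (f e1))) by (eapply valid_same; eauto).
      assert (Hnf : ~ full M (W (f e))).
      { intros HF. apply Hc.
        destruct (stage_interval M (f e) (S (M + c)) 0) as (s & _ & Hs).
        { intros y Hy. apply HF. lia. }
        exists s. apply orb_true_iff. right. apply andb_true_iff.
        split; [now apply Hvb | now apply fullb_upto_spec]. }
      split; intros HF; tauto.
    + intros HT. exfalso. apply H1. eapply no_token_same; eauto.
Qed.

End Image.

(** * The induced map on vertices and edges *)

(** The recursion theorem gives a full [d] on [a], [b] that acquires [a'], [b'] once [v] enters
    [f d]. If [v] never entered, [f d] would have the vertices of [f e], including [v]; so it
    enters, and [f d] has the vertices of [f e']. *)
Lemma image_monotone a b a' b' e e' v :
  a < N -> b < N -> edge N a b = true -> a' < N -> b' < N -> edge N a' b' = true ->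
  (forall x, x = a \/ x = b -> x = a' \/ x = b') ->
  tokens_are N a b (W e) -> full N (W e) ->
  tokens_are N a' b' (W e') -> full N (W e') ->
  v < M -> W (f e) v -> W (f e') v.
Proof.
  intros Ha Hb Hab Ha' Hb' Hab' Hincl T F T' F' Hv Hx.
  destruct (recursion_theorem (fun d x s =>
    (N <=? x) || ((x =? a) || (x =? b)) || (((x =? a') || (x =? b')) && stage (f d) s v)))
    as [d Hd].
  { unfold uncurry3. comp. apply (computable_comp f); comp. }
  assert (Fd : full N (W d)).
  { intros x Lx. apply Hd. exists 0. apply Nat.leb_le in Lx. now rewrite Lx. }
  assert (Td : forall x, x < N ->
    (W d x <-> (x = a \/ x = b) \/ ((x = a' \/ x = b') /\ W (f d) v))).
  { intros x Lx. rewrite Hd. apply Nat.leb_gt in Lx. rewrite Lx. simpl. split.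
    - intros [s Hs]. rewrite orb_true_iff, andb_true_iff, !orb_true_iff, !Nat.eqb_eq in Hs.
      destruct Hs as [Hs|[Hs Hs']]; [now left|right]. split; [exact Hs|].
      eapply stage_W; eauto.
    - intros [H|[H H']].
      + exists 0. rewrite !orb_true_iff, !Nat.eqb_eq. now left.
      + apply W_stage in H' as [s Hs]. exists s.
        rewrite orb_true_iff, andb_true_iff, !orb_true_iff, !Nat.eqb_eq. now right. }
  destruct (classic (W (f d) v)) as [H|H].
  - assert (T2 : tokens_are N a' b' (W d)).
    { intros x Lx. rewrite (Td x Lx). specialize (Hincl x). tauto. }
    destruct (image_of_full a' b' e' Ha' Hb' Hab' T' F' d T2 Fd) as (S1 & _).
    now apply S1.
  - assert (T2 : tokens_are N a b (W d)).
    { intros x Lx. rewrite (Td x Lx). tauto. }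
    destruct (image_of_full a b e Ha Hb Hab T F d T2 Fd) as (S1 & _).
    exfalso. apply H. now apply S1.
Qed.

(** Both images are full on valid vertex sets, so equal vertices put them in one class, and the
    reduction pulls this back. *)
Lemma image_injective a b a' b' e e' :
  a < N -> b < N -> edge N a b = true -> a' < N -> b' < N -> edge N a' b' = true ->
  tokens_are N a b (W e) -> full N (W e) ->
  tokens_are N a' b' (W e') -> full N (W e') ->
  same_tokens M (W (f e)) (W (f e')) -> same_tokens N (W e) (W e').
Proof.
  intros Ha Hb Hab Ha' Hb' Hab' T F T' F' S1.
  destruct (image_valid_full a b e Ha Hb Hab T F) as [V1 G1].
  destruct (image_valid_full a' b' e' Ha' Hb' Hab' T' F') as [_ G2].
  apply Hred. apply cycle_rel_valid; tauto.
Qed.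

Lemma full_index a b : exists e, tokens_are N a b (W e) /\ full N (W e).
Proof.
  destruct (recursion_with_tokens N a b f (fun _ _ _ => true)) as (e & T & HW);
    [exact Hf | unfold uncurry3; comp |].
  exists e. split; [exact T|]. apply full_shift. intros c. apply HW. now exists 0.
Qed.

(* The image of an edge is strictly above the distinct images of its two
   endpoints, so the former is an edge and the latter are its endpoints. *)
Lemma edge_image a e e' :
  2 <= N -> a < N ->
  tokens_are N a a (W e) -> full N (W e) ->
  tokens_are N (cyc_succ N a) (cyc_succ N a) (W e') -> full N (W e') ->
  exists c d, c < M /\ d < M /\ c <> d /\ (d = cyc_succ M c \/ c = cyc_succ M d) /\
    tokens_are M c c (W (f e)) /\ tokens_are M d d (W (f e')).
Proof.
  intros HN Ha T F T' F'. set (a' := cyc_succ N a) in *.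
  assert (Ha' : a' < N) by now apply cyc_succ_lt.
  assert (Hne : a' <> a) by now apply cyc_succ_neq.
  assert (Eaa : forall x, edge N x x = true)
    by (intros x; unfold edge; now rewrite Nat.eqb_refl).
  assert (Eaa' : edge N a a' = true)
    by (unfold edge, a'; now rewrite Nat.eqb_refl, orb_true_r).
  destruct (full_index a a') as (e2 & T2 & F2).
  destruct (image_valid_full a a e Ha Ha (Eaa a) T F)
    as [(x1 & y1 & Hx1 & Hy1 & _ & I1) _].
  destruct (image_valid_full a' a' e' Ha' Ha' (Eaa a') T' F')
    as [(x3 & y3 & Hx3 & Hy3 & _ & I3) _].
  destruct (image_valid_full a a' e2 Ha Ha' Eaa' T2 F2)
    as [(x2 & y2 & Hx2 & Hy2 & E2 & I2) _].
  assert (L1 : forall v, v < M -> v = x1 \/ v = y1 -> v = x2 \/ v = y2).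
  { intros v Hv H. apply (I2 v Hv).
    eapply (image_monotone a a a a' e e2); eauto; [intros; lia|]. now apply (I1 v Hv). }
  assert (L3 : forall v, v < M -> v = x3 \/ v = y3 -> v = x2 \/ v = y2).
  { intros v Hv H. apply (I2 v Hv).
    eapply (image_monotone a' a' a a' e' e2); eauto; [intros; lia|]. now apply (I3 v Hv). }
  assert (D12 : ~ same_tokens M (W (f e)) (W (f e2))).
  { intros H. apply (image_injective a a a a') in H; auto.
    assert (HX : W e2 a') by (apply (T2 a' Ha'); now right).
    apply (H a' Ha'), (T a' Ha') in HX. lia. }
  assert (D32 : ~ same_tokens M (W (f e')) (W (f e2))).
  { intros H. apply (image_injective a' a' a a') in H; auto.
    assert (HX : W e2 a) by (apply (T2 a Ha); now left).
    apply (H a Ha), (T' a Ha) in HX. lia. }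
  assert (D13 : ~ same_tokens M (W (f e)) (W (f e'))).
  { intros H. apply (image_injective a a a' a') in H; auto.
    assert (HX : W e a) by (apply (T a Ha); now left).
    apply (H a Ha), (T' a Ha) in HX. lia. }
  assert (Hcmp : forall i j x y z w, tokens_are M x y (W i) -> tokens_are M z w (W j) ->
    (forall v, v = x \/ v = y <-> v = z \/ v = w) -> same_tokens M (W i) (W j)).
  { intros i j x y z w Hi Hj H v Hv. rewrite (Hi v Hv), (Hj v Hv). apply H. }
  pose proof (fun H => D12 (Hcmp _ _ _ _ _ _ I1 I2 H)) as D12'.
  pose proof (fun H => D32 (Hcmp _ _ _ _ _ _ I3 I2 H)) as D32'.
  pose proof (fun H => D13 (Hcmp _ _ _ _ _ _ I1 I3 H)) as D13'.
  pose proof (L1 x1 Hx1 (or_introl eq_refl)) as A1.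
  pose proof (L1 y1 Hy1 (or_intror eq_refl)) as A2.
  pose proof (L3 x3 Hx3 (or_introl eq_refl)) as A3.
  pose proof (L3 y3 Hy3 (or_intror eq_refl)) as A4.
  (* Two distinct vertices would exhaust the at most two vertices in the image of the edge. *)
  assert (x1 = y1) as <- by (apply NNPP; intros Hn; apply D12'; intros v; lia).
  assert (x3 = y3) as <- by (apply NNPP; intros Hn; apply D32'; intros v; lia).
  assert (Hxx : x1 <> x3) by (intros ->; apply D13'; intros v; tauto).
  exists x1, x3. repeat (split; [assumption|]). split; [|now split].
  unfold edge in E2. rewrite orb_true_iff, !Nat.eqb_eq in E2.
  destruct A1 as [->| ->], A3 as [->| ->]; destruct E2; try lia; auto.
Qed.

End Reduction.

(** * Embeddings of cycles and the conclusion *)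

(** The image of [w] is closed under the successor of [C_M], hence is everything, and counting gives
    [N = M]. *)
Lemma cycle_embedding N M (w : nat -> nat) :
  3 <= N ->
  (forall a, a < N -> w a < M) ->
  (forall a b, a < N -> b < N -> w a = w b -> a = b) ->
  (forall a, a < N ->
    w (cyc_succ N a) = cyc_succ M (w a) \/ w a = cyc_succ M (w (cyc_succ N a))) ->
  N = M.
Proof.
  intros HN Hw Hinj Hadj.
  assert (Hsinj : forall x y, x < M -> y < M -> cyc_succ M x = cyc_succ M y -> x = y).
  { intros x y. unfold cyc_succ.
    destruct (Nat.eqb_spec (S x) M), (Nat.eqb_spec (S y) M); lia. }
  pose (P x := exists a, a < N /\ w a = x).
  assert (Hclosed : forall x, P x -> P (cyc_succ M x)).
  { intros x (a & Ha & <-).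
    pose proof (cyc_succ_lt N a Ha) as Hn.
    destruct (Hadj a Ha) as [E|E]; [now exists (cyc_succ N a)|].
    (* The predecessor [p] of [a] differs from its successor because [N >= 3]. As [w (cyc_succ N a)]
       already precedes [w a], injectivity forces [w p] to follow it. *)
    assert (Hp : exists p, p < N /\ cyc_succ N p = a /\ p <> cyc_succ N a).
    { exists (if a =? 0 then N - 1 else a - 1). unfold cyc_succ.
      destruct (Nat.eqb_spec a 0).
      - replace (S (N - 1) =? N) with true by (symmetry; apply Nat.eqb_eq; lia).
        destruct (Nat.eqb_spec (S a) N); lia.
      - replace (S (a - 1) =? N) with false by (symmetry; apply Nat.eqb_neq; lia).
        destruct (Nat.eqb_spec (S a) N); lia. }
    destruct Hp as (p & Lp & Ep & Np).
    destruct (Hadj p Lp) as [E'|E']; rewrite Ep in E'.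
    - exfalso. apply Np, Hinj; auto. apply Hsinj; auto. congruence.
    - now exists p. }
  assert (Hup : forall x, P x -> forall k, x + k < M -> P (x + k)).
  { intros x Hx. induction k as [|k IH]; intros L; [now rewrite Nat.add_0_r|].
    replace (x + S k) with (cyc_succ M (x + k)).
    - apply Hclosed, IH. lia.
    - unfold cyc_succ. destruct (Nat.eqb_spec (S (x + k)) M); lia. }
  (* From [w 0] the image climbs to [M - 1] and then wraps around to 0. *)
  assert (P0 : P 0).
  { pose proof (Hw 0 ltac:(lia)) as L0.
    replace 0 with (cyc_succ M (w 0 + (M - 1 - w 0))).
    - apply Hclosed, Hup; [exists 0; split; [lia | reflexivity] | lia].
    - unfold cyc_succ. destruct (Nat.eqb_spec (S (w 0 + (M - 1 - w 0))) M); lia. }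
  apply Nat.le_antisymm.
  - rewrite <- (length_seq N 0), <- (length_map w), <- (length_seq M 0).
    apply NoDup_incl_length.
    + apply NoDup_map_NoDup_ForallPairs; [|apply seq_NoDup].
      intros a b Ia Ib. apply in_seq in Ia, Ib. apply Hinj; lia.
    + intros x Hx. apply in_map_iff in Hx as (a & <- & Ia). apply in_seq in Ia.
      apply in_seq. split; [lia|]. apply Hw. lia.
  - rewrite <- (length_seq N 0), <- (length_map w), <- (length_seq M 0).
    apply NoDup_incl_length; [apply seq_NoDup|].
    intros x Hx. apply in_seq in Hx. destruct (Hup 0 P0 x) as (a & La & E); [lia|].
    apply in_map_iff. exists a. split; [exact E|]. apply in_seq. lia.
Qed.

Lemma bounded_choice N (P : nat -> nat -> Prop) :
  (forall a, a < N -> exists w, P a w) -> exists w, forall a, a < N -> P a (w a).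
Proof.
  induction N as [|N IH]; intros H; [exists (fun a => a); lia|].
  destruct IH as [w Hw]; [intros a La; apply H; lia|].
  destruct (H N (Nat.lt_succ_diag_r N)) as [z Hz].
  exists (fun a => if a =? N then z else w a). intros a La.
  destruct (Nat.eqb_spec a N) as [->|]; [exact Hz|]. apply Hw. lia.
Qed.

(** The embedding sends [a] to the only vertex in the image of a full set on [a]. *)
Lemma cycle_rel_reducible_eq N M :
  3 <= N -> reducible (cycle_rel N) (cycle_rel M) -> N = M.
Proof.
  intros HN (f & Hf & Hred).
  destruct (bounded_choice N (fun a e => tokens_are N a a (W e) /\ full N (W e)))
    as [e He]; [intros a _; exact (full_index N f Hf a a)|].
  assert (Hedge : forall a, a < N -> exists c d,
    c < M /\ d < M /\ c <> d /\ (d = cyc_succ M c \/ c = cyc_succ M d) /\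
    tokens_are M c c (W (f (e a))) /\ tokens_are M d d (W (f (e (cyc_succ N a))))).
  { intros a La. destruct (He a La) as [T F].
    destruct (He _ (cyc_succ_lt N a La)) as [T' F'].
    apply (edge_image N M f Hf Hred a); auto. lia. }
  destruct (bounded_choice N (fun a w => w < M /\ tokens_are M w w (W (f (e a)))))
    as [w Hw].
  { intros a La. destruct (Hedge a La) as (c & _ & Lc & _ & _ & _ & Tc & _).
    now exists c. }
  assert (Huniq : forall i c d, c < M -> tokens_are M c c (W i) -> tokens_are M d d (W i) ->
    c = d).
  { intros i c d Lc Tc Td. pose proof (proj2 (Tc c Lc) (or_introl eq_refl)) as H.
    apply (Td c Lc) in H. tauto. }
  apply cycle_embedding with w; auto.
  - intros a La. apply (Hw a La).
  - intros a b La Lb E. destruct (He a La) as [Ta Fa], (He b Lb) as [Tb Fb].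
    assert (S1 : same_tokens N (W (e a)) (W (e b))).
    { assert (Eaa : forall x, edge N x x = true)
        by (intros x; unfold edge; now rewrite Nat.eqb_refl).
      apply (image_injective N M f Hf Hred a a b b); auto.
      eapply tokens_are_same; [apply (Hw a La)|]. rewrite E. apply (Hw b Lb). }
    pose proof (proj2 (Ta a La) (or_introl eq_refl)) as H.
    apply (S1 a La), (Tb a La) in H. tauto.
  - intros a La. destruct (Hedge a La) as (c & d & Lc & Ld & _ & H & Tc & Td).
    rewrite <- (Huniq _ _ _ Lc Tc (proj2 (Hw a La))).
    now rewrite <- (Huniq _ _ _ Ld Td (proj2 (Hw _ (cyc_succ_lt N a La)))).
Qed.

Theorem theorem4p3 :
  exists A : nat -> relation nat,
    (forall n : nat,
        equivalence nat (A n) /\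
        enumerable_in_indices (A n) /\
        reducible eq_ce (A n) /\
        reducible (A n) E0_ce) /\
    (forall n m : nat, n <> m -> ~ reducible (A n) (A m)).
Proof.
  (* The shift by 3 excludes the cycle lengths at which [cycle_embedding] does not apply. *)
  exists (fun n => cycle_rel (n + 3)). split.
  - intros n. split; [apply cycle_rel_equivalence|].
    split; [apply cycle_rel_enumerable|].
    split; [apply eq_ce_le_cycle_rel | apply cycle_rel_le_E0].
  - intros n m Hnm H. apply cycle_rel_reducible_eq in H; lia.
Qed.
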